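(* Let $1<p<\infty$, $\frac1p+\frac1q=1$, let $a,b$ be as in the context, and let $w=(w_n)_{n\ge0}$ be a sequence of nonzero complex numbers with $$\sup_{n\ge0}\Big|\frac{w_na_n}{a_{n+1}}\Big|<\infty\quad\text{and}\quad\limsup_{n\to\infty}\Big|\frac{b_n}{a_{n+1}}\Big|<1$$ (so $F_w$ is bounded on $\ell^p_{a,b}$). Consider the statements: (i) $F_w^*$ is chaotic on $(\ell^p_{a,b})^*$; (ii) $F_w^*$ has a nonzero periodic vector; (iii) $\sum_{n=1}^{\infty}\Big|\frac{a_n}{w_0w_1\cdots w_{n-1}}\Big|^q<\infty$. Then (iii) $\Rightarrow$ (i) $\Rightarrow$ (ii). If in addition $$\sum_{n\ge0}\Big(\sum_{j\ge1}\Big|\prod_{k=1}^{j}\frac{b_{n+k-1}}{a_{n+k}}\Big|^p\Big)^{q/p}<\infty,$$ then (ii) $\Rightarrow$ (iii), so all three statements are equivalent.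
   Context: Let $a=(a_n)_{n\ge0}$, $b=(b_n)_{n\ge0}$ be sequences of nonzero complex numbers with $\limsup_{n\to\infty}(|a_n|+|b_n|)^{1/n}<\infty$, and let $R=1/\limsup_{n}(|a_n|+|b_n|)^{1/n}\in(0,\infty]$. For $n\ge0$ let $f_n(z)=(a_n+b_nz)z^n$. For $1\le p<\infty$, $\ell^p_{a,b}$ is the space of analytic functions on $\{|z|<R\}$ of the form $f=\sum_{n\ge0}\lambda_nf_n$ with $(\lambda_n)\in\ell^p(\mathbb{N}_0)$ (the series converges locally uniformly on $\{|z|<R\}$ and the $\lambda_n$ are uniquely determined by $f$), normed by $\|f\|=(\sum_n|\lambda_n|^p)^{1/p}$. For a sequence $w=(w_n)_{n\ge0}$, the weighted forward shift is $F_w\big(\sum_{n\ge0}\mu_nz^n\big)=\sum_{n\ge0}\mu_nw_nz^{n+1}$; $F_w^*$ is its Banach space adjoint. A vector $v$ is periodic for $T$ if $T^mv=v$ for some $m\ge1$. An operator on a separable Banach space is chaotic if it is hypercyclic (has a dense orbit) and its set of periodic vectors is dense. *)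

(* Defs.v *)
From Stdlib Require Import Reals ClassicalEpsilon.
From Coquelicot Require Import Coquelicot.

Local Open Scope R_scope.

(* Real power |x|^s for x >= 0 (with 0^s := 0, used only for s > 0). *)
Definition rpow (x s : R) : R := if Rlt_dec 0 x then Rpower x s else 0.

Definition cseries (u : nat -> C) (l : C) : Prop := is_series (K := C_AbsRing) u l.

(* A chosen sum of a complex series (meaningful when it converges). *)
Definition csum (u : nat -> C) : C :=
  epsilon (inhabits (RtoC 0)) (fun l => cseries u l).

Section Setting.
Variables (a b : nat -> C) (p : R).

(* L = limsup (|a_n| + |b_n|)^(1/n); the radius is R = 1/L, so |z| < R iff |z| L < 1. *)
Definition Lrad : R :=
  real (LimSup_seq (fun n => rpow (Cmod (a n) + Cmod (b n)) (/ INR n))).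

Definition in_disc (z : C) : Prop := Cmod z * Lrad < 1.

Definition fn (n : nat) (z : C) : C := Cmult (Cplus (a n) (Cmult (b n) z)) (Cpow z n).

Definition in_lp (lam : nat -> C) : Prop := ex_series (fun n => rpow (Cmod (lam n)) p).

Definition represents (lam : nat -> C) (f : C -> C) : Prop :=
  forall z, in_disc z -> cseries (fun n => Cmult (lam n) (fn n z)) (f z).

Definition inE (f : C -> C) : Prop := exists lam, in_lp lam /\ represents lam f.

(* the (unique) coefficient sequence of f, and the norm of l^p_{a,b} *)
Definition coefs (f : C -> C) : nat -> C :=
  epsilon (inhabits (fun _ => RtoC 0)) (fun lam => in_lp lam /\ represents lam f).

Definition normE (f : C -> C) : R :=
  rpow (Series (fun n => rpow (Cmod (coefs f n)) p)) (/ p).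

Definition taylor (f : C -> C) : nat -> C :=
  epsilon (inhabits (fun _ => RtoC 0))
    (fun mu => forall z, in_disc z -> cseries (fun n => Cmult (mu n) (Cpow z n)) (f z)).

Definition Fw (w : nat -> C) (f : C -> C) : C -> C :=
  fun z => csum (fun n => Cmult (Cmult (taylor f n) (w n)) (Cpow z (S n))).

Definition functional := (C -> C) -> C.

Definition linearE (phi : functional) : Prop :=
  forall f g (c : C), inE f -> inE g ->
    phi (fun z => Cplus (f z) (Cmult c (g z))) = Cplus (phi f) (Cmult c (phi g)).

Definition boundedE (phi : functional) : Prop :=
  exists M, forall f, inE f -> Cmod (phi f) <= M * normE f.

Definition inDual (phi : functional) : Prop := linearE phi /\ boundedE phi.

(* dual norm ||phi|| < eps  (||phi|| = least c >= 0 with |phi f| <= c ||f||) *)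
Definition dnorm_lt (phi : functional) (eps : R) : Prop :=
  exists c, 0 <= c /\ c < eps /\ forall f, inE f -> Cmod (phi f) <= c * normE f.

Definition fsub (phi psi : functional) : functional := fun f => Cminus (phi f) (psi f).

Definition Fwstar (w : nat -> C) (phi : functional) : functional := fun f => phi (Fw w f).

(* equality in the dual = equality as functionals on l^p_{a,b} *)
Definition periodic (T : functional -> functional) (phi : functional) : Prop :=
  exists m : nat, (1 <= m)%nat /\ forall f, inE f -> Nat.iter m T phi f = phi f.

Definition hypercyclic (T : functional -> functional) : Prop :=
  exists phi, inDual phi /\
    forall psi, inDual psi -> forall eps, 0 < eps ->
      exists n : nat, dnorm_lt (fsub (Nat.iter n T phi) psi) eps.

Definition dense_periodic (T : functional -> functional) : Prop :=
  forall psi, inDual psi -> forall eps, 0 < eps ->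
    exists phi, inDual phi /\ periodic T phi /\ dnorm_lt (fsub phi psi) eps.

Definition chaotic (T : functional -> functional) : Prop :=
  hypercyclic T /\ dense_periodic T.

Definition nonzero_periodic (T : functional -> functional) : Prop :=
  exists phi, inDual phi /\ periodic T phi /\ exists f, inE f /\ phi f <> RtoC 0.

End Setting.

Fixpoint wprod (w : nat -> C) (n : nat) : C :=
  match n with O => RtoC 1 | S k => Cmult (wprod w k) (w k) end.

Fixpoint baprod (a b : nat -> C) (n j : nat) : C :=
  match j with
  | O => RtoC 1
  | S k => Cmult (baprod a b n k) (Cdiv (b (n + k)%nat) (a (n + S k)%nat))
  end.

(* Main.v *)
Require Import Defs.
From Stdlib Require Import Reals Lra Lia ClassicalEpsilon Cantor.
From Coquelicot Require Import Coquelicot.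
Local Open Scope R_scope.

(** Writing [f = sum mu_n z^n] and [x_n = mu_n / a_n], the passage from the coefficients
    [lam] of [f] to [x] is [I + S], where [S] is the weighted forward shift with weights
    [b_n / a_(n+1)]. Their limsup is [< 1], so [I + S] is invertible on [l^p] and the space
    is the set of [f] with [x] in [l^p], with an equivalent norm. By [l^p]-[l^q] duality the
    functionals are [f |-> sum U_n mu_n / (w_0 ... w_(n-1))] with [sum |U_n g_n|^q] finite,
    where [g_n = a_n / (w_0 ... w_(n-1))], and the adjoint of [F_w] becomes the plain left
    shift of [U]. Its periodic vectors are periodic sequences, and condition (iii) says that
    bounded sequences are admissible: truncations can then be periodised, and a sequence
    concatenating all finite rational sequences with long enough gaps has a dense orbit.
    Conversely a nonzero periodic [U] makes [|g_n|^q] summable along an arithmetic progression,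
    hence everywhere, because [|g_n / g_(n+1)| = |w_n a_n / a_(n+1)|] is bounded. *)

(** * Real powers *)

(** The norm is read off the [lam], while the shift acts on Taylor coefficients, so estimates must
    pass both ways with constants independent of [f]. Finitely many of the weights b_n / a_(n+1) may
    be large; they cost a constant, and the remaining ones are absorbed as a contraction. Constants
    are otherwise harmless, so sums are estimated through p-th powers, by convexity and by x + y <=
    2 max(x, y).

    The objects [coefs], [taylor] and [csum] are choices: they are controlled by existence together
    with uniqueness of the Taylor expansion, which reduces to real power series near 0.

    The coordinates U come from F_w z^n = w_n z^(n+1): under the adjoint, the numbers w_0 ...
    w_(n-1) phi(z^n) move one place to the left. The pairing with [f] then reads sum x_n (U_n g_n),
    whence the weight |g_n|^q on |U_n|^q. *)

Lemma rpow_pos x s : 0 < x -> rpow x s = Rpower x s.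
Proof. intros Hx; unfold rpow; destruct (Rlt_dec 0 x); [reflexivity | lra]. Qed.

Lemma rpow_zero s : rpow 0 s = 0.
Proof. unfold rpow; destruct (Rlt_dec 0 0); [lra | reflexivity]. Qed.

Lemma rpow_ge0 x s : 0 <= rpow x s.
Proof.
  unfold rpow; destruct (Rlt_dec 0 x); [|lra].
  left; apply exp_pos.
Qed.

Lemma rpow_gt0 x s : 0 < x -> 0 < rpow x s.
Proof. intros Hx; rewrite rpow_pos by assumption; apply exp_pos. Qed.

Lemma rpow_1_r x : 0 <= x -> rpow x 1 = x.
Proof.
  intros [Hx | <-]; [|apply rpow_zero].
  rewrite rpow_pos by assumption; now apply Rpower_1.
Qed.

Lemma rpow_rpow x s t : 0 <= x -> rpow (rpow x s) t = rpow x (s * t).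
Proof.
  intros [Hx | <-]; [|now rewrite !rpow_zero].
  rewrite (rpow_pos (rpow x s)) by now apply rpow_gt0.
  rewrite !rpow_pos by assumption; apply Rpower_mult.
Qed.

(** The convention that [rpow] vanishes off the positive reals makes the law hold for every [x] and
    for negative exponents. *)
Lemma rpow_plus x s t : rpow x (s + t) = rpow x s * rpow x t.
Proof.
  unfold rpow; destruct (Rlt_dec 0 x); [apply Rpower_plus | ring].
Qed.

Lemma rpow_mult x y s : 0 <= x -> 0 <= y -> rpow (x * y) s = rpow x s * rpow y s.
Proof.
  intros [Hx | <-] [Hy | <-]; rewrite ?Rmult_0_l, ?Rmult_0_r, ?rpow_zero; try ring.
  rewrite !rpow_pos by (try apply Rmult_lt_0_compat; assumption).
  symmetry; now apply Rpower_mult_distr.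
Qed.

Lemma rpow_le x y s : 0 <= s -> 0 <= x -> x <= y -> rpow x s <= rpow y s.
Proof.
  intros Hs [Hx | <-] Hxy; [|rewrite rpow_zero; apply rpow_ge0].
  rewrite !rpow_pos by lra; apply Rle_Rpower_l; lra.
Qed.

Lemma rpow_inv_r x s : s <> 0 -> 0 <= x -> rpow (rpow x s) (/ s) = x.
Proof. intros Hs Hx; rewrite rpow_rpow, Rinv_r by assumption; now apply rpow_1_r. Qed.

Lemma rpow_inv_l x s : s <> 0 -> 0 <= x -> rpow (rpow x (/ s)) s = x.
Proof. intros Hs Hx; rewrite rpow_rpow, Rinv_l by assumption; now apply rpow_1_r. Qed.

(** From x + y <= 2 max(x, y). It serves as the triangle inequality for sums of powers. *)
Lemma rpow_add_le x y s : 0 <= s -> 0 <= x -> 0 <= y ->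
  rpow (x + y) s <= rpow 2 s * (rpow x s + rpow y s).
Proof.
  intros Hs Hx Hy.
  pose proof (rpow_ge0 2 s); pose proof (rpow_ge0 x s); pose proof (rpow_ge0 y s).
  destruct (Rle_dec x y).
  - apply Rle_trans with (rpow (2 * y) s).
    + apply rpow_le; lra.
    + rewrite rpow_mult by lra; apply Rmult_le_compat_l; lra.
  - apply Rle_trans with (rpow (2 * x) s).
    + apply rpow_le; lra.
    + rewrite rpow_mult by lra; apply Rmult_le_compat_l; lra.
Qed.

Lemma ln_le_sub1 x : 0 < x -> ln x <= x - 1.
Proof.
  intros Hx; pose proof (exp_ineq1_le (ln x)) as H.
  rewrite exp_ln in H by assumption; lra.
Qed.

(** Concavity of the logarithm, through its tangent at the weighted mean m: in ln(x/m) <= x/m - 1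
    and ln(y/m) <= y/m - 1 the right-hand sides average to 0. *)
Lemma weighted_amgm x y t : 0 < t < 1 -> 0 <= x -> 0 <= y ->
  rpow x t * rpow y (1 - t) <= t * x + (1 - t) * y.
Proof.
  intros Ht [Hx | <-] [Hy | <-]; rewrite ?rpow_zero; try nra.
  rewrite !rpow_pos by assumption; unfold Rpower; rewrite <- exp_plus.
  set (m := t * x + (1 - t) * y).
  assert (Hm : 0 < m) by (unfold m; nra).
  rewrite <- (exp_ln m) by assumption.
  assert (Hle : t * ln x + (1 - t) * ln y <= ln m).
  { pose proof (ln_le_sub1 (x / m) (Rdiv_lt_0_compat _ _ Hx Hm)) as H1.
    pose proof (ln_le_sub1 (y / m) (Rdiv_lt_0_compat _ _ Hy Hm)) as H2.
    rewrite ln_div in H1, H2 by assumption.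
    assert (t * (x / m - 1) + (1 - t) * (y / m - 1) = 0)
      by (unfold m; field; fold m; lra).
    nra. }
  destruct Hle as [Hlt | ->]; [left; now apply exp_increasing | right; reflexivity].
Qed.

Lemma young_rpow x y p q : 1 < p -> / p + / q = 1 -> 0 <= x -> 0 <= y ->
  x * y <= / p * rpow x p + / q * rpow y q.
Proof.
  intros Hp Hpq Hx Hy.
  assert (Hip : 0 < / p < 1)
    by (split; [apply Rinv_0_lt_compat | rewrite <- Rinv_1; apply Rinv_lt_contravar]; lra).
  assert (Hq : q <> 0) by (intros ->; rewrite Rinv_0 in Hpq; lra).
  pose proof (weighted_amgm (rpow x p) (rpow y q) (/ p) Hip (rpow_ge0 _ _) (rpow_ge0 _ _)) as H.
  replace (1 - / p) with (/ q) in H by lra.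
  rewrite !rpow_inv_r in H by lra; exact H.
Qed.

(** The graph of the p-th power lies above its tangent at m. Averaging two such inequalities at the
    mean gives convexity below. *)
Lemma rpow_tangent x m p : 1 < p -> 0 <= x -> 0 < m ->
  p * x * rpow m (p - 1) <= rpow x p + (p - 1) * rpow m p.
Proof.
  intros Hp Hx Hm.
  assert (Hip : 0 < / p < 1)
    by (split; [apply Rinv_0_lt_compat | rewrite <- Rinv_1; apply Rinv_lt_contravar]; lra).
  pose proof (weighted_amgm (rpow x p) (rpow m p) (/ p) Hip (rpow_ge0 _ _) (rpow_ge0 _ _)) as H.
  rewrite rpow_inv_r, rpow_rpow in H by lra.
  replace (p * (1 - / p)) with (p - 1) in H by (field; lra).
  apply (Rmult_le_compat_l p) in H; [|lra].
  replace (p * (/ p * rpow x p + (1 - / p) * rpow m p))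
    with (rpow x p + (p - 1) * rpow m p) in H by (field; lra).
  lra.
Qed.

Lemma rpow_convex x y t p : 1 < p -> 0 < t < 1 -> 0 <= x -> 0 <= y ->
  rpow (t * x + (1 - t) * y) p <= t * rpow x p + (1 - t) * rpow y p.
Proof.
  intros Hp Ht Hx Hy; set (m := t * x + (1 - t) * y).
  destruct (Rlt_le_dec 0 m) as [Hm | Hm].
  - pose proof (rpow_tangent x m p Hp Hx Hm) as H1.
    pose proof (rpow_tangent y m p Hp Hy Hm) as H2.
    assert (Hpm : rpow m p = m * rpow m (p - 1)).
    { replace p with (1 + (p - 1)) at 1 by ring.
      rewrite rpow_plus, rpow_1_r by lra; reflexivity. }
    apply (Rmult_le_compat_l t) in H1; [|lra].
    apply (Rmult_le_compat_l (1 - t)) in H2; [|lra].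
    assert (E : t * (p * x * rpow m (p - 1)) + (1 - t) * (p * y * rpow m (p - 1))
                = p * rpow m p) by (rewrite Hpm; unfold m; ring).
    lra.
  - unfold rpow at 1; destruct (Rlt_dec 0 m); [lra|].
    pose proof (rpow_ge0 x p); pose proof (rpow_ge0 y p); nra.
Qed.

(** Convexity applied to x + r y = (1 - r) (x / (1 - r)) + r y. The factor 2^s of [rpow_add_le]
    would destroy the coefficient r < 1 in front of the power of y. *)
Lemma rpow_add_contract r p : 1 < p -> 0 < r < 1 ->
  exists K, 0 <= K /\ forall x y, 0 <= x -> 0 <= y ->
    rpow (x + r * y) p <= K * rpow x p + r * rpow y p.
Proof.
  intros Hp Hr; exists ((1 - r) * rpow (/ (1 - r)) p); split.
  { pose proof (rpow_ge0 (/ (1 - r)) p); nra. }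
  intros x y Hx Hy.
  assert (Hi : 0 < / (1 - r)) by (apply Rinv_0_lt_compat; lra).
  pose proof (rpow_convex (/ (1 - r) * x) y (1 - r) p Hp ltac:(lra)
                ltac:(nra) Hy) as H.
  rewrite rpow_mult in H by lra.
  replace ((1 - r) * (/ (1 - r) * x) + (1 - (1 - r)) * y) with (x + r * y) in H
    by (field; lra).
  lra.
Qed.

(** * Series *)

Lemma sum_n_RS (u : nat -> R) n : sum_n u (S n) = sum_n u n + u (S n).
Proof. exact (sum_Sn u n). Qed.

Lemma sum_n_CS (u : nat -> C) n : sum_n u (S n) = Cplus (sum_n u n) (u (S n)).
Proof. exact (sum_Sn u n). Qed.

(** For nonnegative terms this says at once that the series converges and that its sum is at most B,
    and so avoids the meaningless value of [Series] on a divergent series. *)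
Definition sums_le (u : nat -> R) (B : R) : Prop := forall N, sum_n u N <= B.

Lemma sum_n_nneg (u : nat -> R) N : (forall n, 0 <= u n) -> 0 <= sum_n u N.
Proof.
  intros Hu; induction N as [|N IH]; [rewrite sum_O; apply Hu|].
  rewrite sum_n_RS; specialize (Hu (S N)); lra.
Qed.

Lemma sum_n_incr (u : nat -> R) M i : (forall n, 0 <= u n) -> sum_n u M <= sum_n u (M + i).
Proof.
  intros Hu; induction i as [|i IH]; [rewrite Nat.add_0_r; apply Rle_refl|].
  rewrite Nat.add_succ_r, sum_n_RS; specialize (Hu (S (M + i))); lra.
Qed.

Lemma sum_n_le (u v : nat -> R) N :
  (forall n, u n <= v n) -> sum_n u N <= sum_n v N.
Proof.
  intros H; induction N as [|N IH]; [rewrite !sum_O; apply H|].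
  rewrite !sum_n_RS; specialize (H (S N)); lra.
Qed.

Lemma sums_le_mono u v B : (forall n, u n <= v n) -> sums_le v B -> sums_le u B.
Proof. intros H Hv N; eapply Rle_trans; [apply sum_n_le, H | apply Hv]. Qed.

Lemma sums_le_plus u v A B : sums_le u A -> sums_le v B ->
  sums_le (fun n => u n + v n) (A + B).
Proof.
  intros Hu Hv N; specialize (Hu N); specialize (Hv N).
  pose proof (sum_n_plus u v N) as E; simpl in E; unfold plus in E; simpl in E.
  eapply Rle_trans; [right; exact E | lra].
Qed.

Lemma sums_le_scal u c B : 0 <= c -> sums_le u B -> sums_le (fun n => c * u n) (c * B).
Proof.
  intros Hc Hu N; specialize (Hu N).
  pose proof (sum_n_mult_l c u N) as E; unfold mult in E; simpl in E.
  eapply Rle_trans; [right; exact E|]; apply Rmult_le_compat_l; assumption.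
Qed.

Lemma sums_le_term u B n : (forall k, 0 <= u k) -> sums_le u B -> u n <= B.
Proof.
  intros Hu HB; apply Rle_trans with (sum_n u n); [|apply HB].
  destruct n as [|n]; [rewrite sum_O; lra|].
  rewrite sum_n_RS; pose proof (sum_n_nneg u n Hu); lra.
Qed.

Lemma sums_le_ex_series u B : (forall n, 0 <= u n) -> sums_le u B -> ex_series u.
Proof.
  intros Hu HB.
  destruct (ex_finite_lim_seq_incr (sum_n u) B) as [l Hl].
  - intros n; rewrite sum_n_RS; specialize (Hu (S n)); lra.
  - apply HB.
  - exists l; exact Hl.
Qed.

Lemma sums_le_Series_le u B : ex_series u -> sums_le u B -> Series u <= B.
Proof.
  intros Hex HB.
  pose proof (Series_correct u Hex) as H.
  exact (is_lim_seq_le (sum_n u) (fun _ => B) (Series u) B HB H (is_lim_seq_const B)).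
Qed.

Lemma sums_le_Series u : (forall n, 0 <= u n) -> ex_series u -> sums_le u (Series u).
Proof.
  intros Hu Hex N.
  pose proof (Series_correct u Hex) as H.
  apply (is_lim_seq_incr_compare (sum_n u) (Series u) H).
  intros n; rewrite sum_n_RS; specialize (Hu (S n)); lra.
Qed.

Lemma Series_nneg u : (forall n, 0 <= u n) -> ex_series u -> 0 <= Series u.
Proof.
  intros Hu Hex; apply Rle_trans with (sum_n u 0);
    [rewrite sum_O; apply Hu | now apply sums_le_Series].
Qed.

Lemma ex_series_dom (u v : nat -> R) :
  (forall n, 0 <= u n <= v n) -> ex_series v -> ex_series u.
Proof.
  intros H Hv; apply (ex_series_le u v); [|exact Hv].
  intros n; destruct (H n); unfold norm; simpl; unfold abs; simpl.
  rewrite Rabs_pos_eq; assumption.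
Qed.

(** The beginning is replaced by zeros and the indices are kept, so that a tail can be added
    termwise to other sequences. *)
Definition tail {G : AbelianMonoid} (M : nat) (u : nat -> G) : nat -> G :=
  fun n => if (n <? M)%nat then zero else u n.

Lemma sum_n_tail {G : AbelianMonoid} (u : nat -> G) M N :
  sum_n (tail M u) N = sum_n_m u M N.
Proof.
  unfold tail; induction N as [|N IH].
  - rewrite sum_O; destruct (Nat.ltb_spec 0 M).
    + now rewrite sum_n_m_zero.
    + replace M with 0%nat by lia; now rewrite sum_n_n.
  - rewrite sum_Sn, IH; destruct (Nat.ltb_spec (S N) M).
    + rewrite !sum_n_m_zero by lia; apply plus_zero_l.
    + now rewrite sum_n_Sm.
Qed.

Lemma sums_le_tail u eps : ex_series u -> 0 < eps ->
  exists N, forall M, (N <= M)%nat -> sums_le (tail (G := R_AbelianMonoid) M u) eps.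
Proof.
  intros Hex Heps.
  destruct (Cauchy_ex_series (V := R_CompleteNormedModule) u Hex (mkposreal eps Heps))
    as [N HN].
  exists N; intros M HM k.
  change (@sum_n R_AbelianMonoid (tail M u) k <= eps).
  rewrite sum_n_tail.
  destruct (Nat.lt_ge_cases k M).
  - rewrite sum_n_m_zero by assumption; unfold zero; simpl; lra.
  - specialize (HN M k HM ltac:(lia)); simpl in HN.
    unfold norm in HN; simpl in HN; unfold abs in HN; simpl in HN.
    eapply Rle_trans; [apply Rle_abs | left; exact HN].
Qed.

Lemma sums_le_shift u B m : (forall n, 0 <= u n) -> sums_le u B ->
  sums_le (fun n => u (n + m)%nat) B.
Proof.
  intros Hu HB N; apply Rle_trans with (sum_n u (N + m)); [|apply HB].
  induction N as [|N IH].
  - rewrite sum_O; destruct m as [|m]; [rewrite sum_O; apply Rle_refl|].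
    rewrite Nat.add_0_l, sum_n_RS; pose proof (sum_n_nneg u m Hu); lra.
  - rewrite Nat.add_succ_l, !sum_n_RS, Nat.add_succ_l; lra.
Qed.

(** Each term lies in at most m + 1 of the windows. *)
Lemma sums_le_window (u : nat -> R) B m : (forall n, 0 <= u n) -> sums_le u B ->
  sums_le (fun i => sum_n (fun l => u (i + l)%nat) m) (INR (S m) * B).
Proof.
  intros Hu HB; induction m as [|m IH].
  - eapply sums_le_mono; [|replace (INR 1 * B) with B by (simpl; ring);
      exact (sums_le_shift u B 0 Hu HB)].
    intros i; rewrite sum_O; apply Rle_refl.
  - replace (INR (S (S m)) * B) with (INR (S m) * B + B) by (rewrite (S_INR (S m)); ring).
    eapply sums_le_mono; [|exact (sums_le_plus _ _ _ _ IH (sums_le_shift u B (S m) Hu HB))].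
    intros i; rewrite sum_n_RS; apply Rle_refl.
Qed.

(** Young's inequality for x_n / A^(1/p) and y_n / B^(1/q). As A and B are positive upper bounds and
    not the sums themselves, the normalisation never divides by 0. *)
Lemma holder_sums (x y : nat -> R) p q A B : 1 < p -> / p + / q = 1 ->
  (forall n, 0 <= x n) -> (forall n, 0 <= y n) -> 0 < A -> 0 < B ->
  sums_le (fun n => rpow (x n) p) A -> sums_le (fun n => rpow (y n) q) B ->
  sums_le (fun n => x n * y n) (rpow A (/ p) * rpow B (/ q)).
Proof.
  intros Hp Hpq Hx Hy HA HB HxA HyB.
  assert (Hip : 0 < / p < 1)
    by (split; [apply Rinv_0_lt_compat | rewrite <- Rinv_1; apply Rinv_lt_contravar]; lra).
  assert (Hq : q <> 0) by (intros ->; rewrite Rinv_0 in Hpq; lra).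
  set (c := rpow A (/ p)); set (d := rpow B (/ q)).
  assert (Hc : 0 < c) by now apply rpow_gt0.
  assert (Hd : 0 < d) by now apply rpow_gt0.
  assert (Hterm : forall n, x n * y n <= c * d * (/ p * (/ A * rpow (x n) p)
                                       + / q * (/ B * rpow (y n) q))).
  { intros n.
    assert (Hic : 0 < / c) by now apply Rinv_0_lt_compat.
    assert (Hid : 0 < / d) by now apply Rinv_0_lt_compat.
    pose proof (young_rpow (x n * / c) (y n * / d) p q Hp Hpq
       (Rmult_le_pos _ _ (Hx n) (Rlt_le _ _ Hic))
       (Rmult_le_pos _ _ (Hy n) (Rlt_le _ _ Hid))) as Y.
    rewrite !rpow_mult in Y by (try apply Hx; try apply Hy; lra).
    assert (Ec : rpow (/ c) p = / A).
    { apply (Rmult_eq_reg_l A); [|lra].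
      rewrite Rinv_r by lra.
      rewrite <- (rpow_inv_l A p) at 1 by lra; fold c.
      rewrite <- rpow_mult by lra.
      rewrite Rinv_r by lra.
      rewrite rpow_pos by lra; unfold Rpower; now rewrite ln_1, Rmult_0_r, exp_0. }
    assert (Ed : rpow (/ d) q = / B).
    { apply (Rmult_eq_reg_l B); [|lra].
      rewrite Rinv_r by lra.
      rewrite <- (rpow_inv_l B q) at 1 by lra; fold d.
      rewrite <- rpow_mult by lra.
      rewrite Rinv_r by lra.
      rewrite rpow_pos by lra; unfold Rpower; now rewrite ln_1, Rmult_0_r, exp_0. }
    rewrite Ec, Ed in Y.
    apply (Rmult_le_compat_l (c * d)) in Y; [|nra].
    replace (c * d * (x n * / c * (y n * / d))) with (x n * y n) in Y by (field; lra).
    lra. }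
  assert (HiA : 0 <= / A) by (left; now apply Rinv_0_lt_compat).
  assert (HiB : 0 <= / B) by (left; now apply Rinv_0_lt_compat).
  eapply sums_le_mono; [exact Hterm|].
  assert (E : c * d = c * d * (/ p * (/ A * A) + / q * (/ B * B))).
  { rewrite !Rinv_l by lra; rewrite !Rmult_1_r, Hpq; ring. }
  rewrite E at 1.
  apply (sums_le_scal (fun n => / p * (/ A * rpow (x n) p) + / q * (/ B * rpow (y n) q)));
    [nra|].
  apply (sums_le_plus (fun n => / p * (/ A * rpow (x n) p))
                      (fun n => / q * (/ B * rpow (y n) q))).
  - apply (sums_le_scal (fun n => / A * rpow (x n) p)); [lra|].
    now apply (sums_le_scal (fun n => rpow (x n) p)).
  - apply (sums_le_scal (fun n => / B * rpow (y n) q)); [lra|].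
    now apply (sums_le_scal (fun n => rpow (y n) q)).
Qed.

(** * Complex series *)

Lemma cseries_eps (u : nat -> C) (l : C) :
  cseries u l <->
  forall eps, 0 < eps -> exists N, forall n, (N <= n)%nat -> Cmod (sum_n u n - l)%C < eps.
Proof.
  unfold cseries, is_series.
  rewrite (filterlim_locally_ball_norm (K := C_AbsRing) (U := C_NormedModule)).
  split.
  - intros H eps Heps; destruct (H (mkposreal eps Heps)) as [N HN].
    exists N; intros n Hn; exact (HN n Hn).
  - intros H eps; destruct (H eps (cond_pos eps)) as [N HN].
    exists N; intros n Hn; exact (HN n Hn).
Qed.

Lemma cseries_unique u l l' : cseries u l -> cseries u l' -> l = l'.
Proof. exact (filterlim_locally_unique (K := C_AbsRing) (V := C_NormedModule) _ l l'). Qed.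

Lemma cseries_ext u v l : (forall n, u n = v n) -> cseries u l -> cseries v l.
Proof. exact (is_series_ext (K := C_AbsRing) (V := C_NormedModule) u v l). Qed.

Lemma cseries_plus u v l m : cseries u l -> cseries v m ->
  cseries (fun n => Cplus (u n) (v n)) (Cplus l m).
Proof. exact (is_series_plus (K := C_AbsRing) (V := C_NormedModule) u v l m). Qed.

Lemma cseries_scal c u l : cseries u l -> cseries (fun n => Cmult c (u n)) (Cmult c l).
Proof. exact (is_series_scal (K := C_AbsRing) (V := C_NormedModule) c u l). Qed.

Lemma cseries_minus u v l m : cseries u l -> cseries v m ->
  cseries (fun n => Cminus (u n) (v n)) (Cminus l m).
Proof. exact (is_series_minus (K := C_AbsRing) (V := C_NormedModule) u v l m). Qed.

Lemma cseries_cons u l : cseries (fun n => u (S n)) l -> cseries u (u 0%nat + l)%C.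
Proof.
  intros H; apply (is_series_decr_1 (K := C_AbsRing) (V := C_NormedModule)).
  match goal with |- is_series _ ?x => replace x with l; [exact H|] end.
  change (l = (u 0%nat + l + - u 0%nat)%C); ring.
Qed.

Lemma cseries_uncons u l : cseries u l -> cseries (fun n => u (S n)) (l - u 0%nat)%C.
Proof.
  intros H; apply (is_series_incr_1 (K := C_AbsRing) (V := C_NormedModule)).
  match goal with |- is_series _ ?x => replace x with l; [exact H|] end.
  change (l = (l - u 0%nat + u 0%nat)%C); ring.
Qed.

Lemma cseries_of_abs u : ex_series (fun n => Cmod (u n)) -> exists l, cseries u l.
Proof.
  intros H; apply (ex_series_le (V := C_CompleteNormedModule) u (fun n => Cmod (u n)));
    [|exact H].
  intros n; apply Rle_refl.
Qed.

Lemma Cmod_sum_n_le (u : nat -> C) N : Cmod (sum_n u N) <= sum_n (fun n => Cmod (u n)) N.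
Proof.
  induction N as [|N IH]; [rewrite !sum_O; apply Rle_refl|].
  rewrite sum_n_CS, sum_n_RS.
  eapply Rle_trans; [apply Cmod_triangle | lra].
Qed.

Lemma cseries_Cmod_le u l B : cseries u l -> sums_le (fun n => Cmod (u n)) B -> Cmod l <= B.
Proof.
  intros Hl HB; apply le_epsilon; intros eps Heps.
  destruct (proj1 (cseries_eps u l) Hl eps Heps) as [N HN].
  specialize (HN N (Nat.le_refl N)); specialize (HB N).
  pose proof (Cmod_sum_n_le u N).
  replace l with (sum_n u N - (sum_n u N - l))%C by ring.
  unfold Cminus at 1; eapply Rle_trans; [apply Cmod_triangle|].
  rewrite Cmod_opp; lra.
Qed.

Lemma cseries_finite (u : nat -> C) N :
  (forall n, (N < n)%nat -> u n = 0%C) -> cseries u (sum_n u N).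
Proof.
  intros Hu; apply cseries_eps; intros eps Heps; exists N.
  intros n Hn.
  assert (E : sum_n u n = sum_n u N).
  { induction Hn as [|n Hn IH]; [reflexivity|].
    rewrite sum_n_CS, IH, (Hu (S n)) by lia; apply Cplus_0_r. }
  rewrite E; unfold Cminus; rewrite Cplus_opp_r, Cmod_0; exact Heps.
Qed.

Lemma csum_correct u : (exists l, cseries u l) -> cseries u (csum u).
Proof. intros H; unfold csum; now apply epsilon_spec. Qed.

Lemma cseries_Re_Im u l : cseries u l ->
  is_series (fun n => Re (u n)) (Re l) /\ is_series (fun n => Im (u n)) (Im l).
Proof.
  intros H.
  assert (HR : forall n, sum_n (fun n => Re (u n)) n = Re (sum_n u n)).
  { induction n as [|n IH]; [now rewrite !sum_O|]. rewrite sum_n_RS, sum_n_CS, IH; reflexivity. }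
  assert (HI : forall n, sum_n (fun n => Im (u n)) n = Im (sum_n u n)).
  { induction n as [|n IH]; [now rewrite !sum_O|]. rewrite sum_n_RS, sum_n_CS, IH; reflexivity. }
  split; apply (filterlim_locally_ball_norm (K := R_AbsRing) (U := R_NormedModule));
    intros eps; destruct (proj1 (cseries_eps u l) H eps (cond_pos eps)) as [N HN];
    exists N; intros n Hn; specialize (HN n Hn);
    pose proof (Rmax_Cmod (sum_n u n - l)%C) as Hm;
    unfold ball_norm, norm, minus, plus, opp; simpl; unfold abs; simpl;
    (eapply Rle_lt_trans; [|exact HN]); (eapply Rle_trans; [|exact Hm]).
  - rewrite HR; apply Rmax_l.
  - rewrite HI; apply Rmax_r.
Qed.

(** * Uniqueness of power series coefficients *)

(** Convergence at d/2 bounds the terms there, so the radius of convergence is positive. The sum is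
    then the zero function near 0, and its n-th derivative at 0 is n! c_n. *)
Lemma real_pseries_zero (c : nat -> R) (d : R) : 0 < d ->
  (forall t, Rabs t < d -> is_series (fun n => c n * t ^ n) 0) -> forall n, c n = 0.
Proof.
  intros Hd H n.
  assert (Hrad : Rbar_lt 0 (CV_radius c)).
  { apply Rbar_lt_le_trans with (Finite (d / 2)); [simpl; lra|].
    apply (proj1 (CV_radius_bounded c)).
    assert (Hs : is_series (fun n => c n * (d / 2) ^ n) 0)
      by (apply H; rewrite Rabs_pos_eq; lra).
    assert (Hl : is_lim_seq (fun n => c n * (d / 2) ^ n) 0)
      by (apply ex_series_lim_0; now exists 0).
    destruct (filterlim_bounded (K := R_AbsRing) (V := R_NormedModule)
                (fun n => c n * (d / 2) ^ n)) as [M HM]; [now exists 0|].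
    exists M; exact HM. }
  pose proof (Derive_n_coef c n Hrad) as E.
  rewrite (Derive_n_ext_loc (PSeries c) (fun _ => 0) n 0) in E.
  - assert (Hz : Derive_n (fun _ : R => 0) n 0 = 0)
      by (destruct n; [reflexivity | apply Derive_n_const]).
    apply (eq_trans (eq_sym E)) in Hz; clear E; rename Hz into E.
    apply Rmult_integral in E; destruct E as [E | E]; [exact E|].
    exfalso; now apply (INR_fact_neq_0 n).
  - exists (mkposreal d Hd); intros t Ht; simpl.
    apply is_series_unique.
    assert (Hs : is_series (fun n => c n * t ^ n) 0).
    { apply H; change (Rabs (t + - 0) < d) in Ht.
      now rewrite Ropp_0, Rplus_0_r in Ht. }
    revert Hs; apply is_series_ext; intros k; reflexivity.
Qed.

(** For real t the real and imaginary parts of the difference are real power series with sum 0. *)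
Lemma complex_pseries_unique (mu nu : nat -> C) (f : R -> C) (d : R) : 0 < d ->
  (forall t, Rabs t < d -> cseries (fun n => Cmult (mu n) (Cpow (RtoC t) n)) (f t)) ->
  (forall t, Rabs t < d -> cseries (fun n => Cmult (nu n) (Cpow (RtoC t) n)) (f t)) ->
  forall n, mu n = nu n.
Proof.
  intros Hd Hmu Hnu n.
  assert (H : forall t, Rabs t < d ->
    is_series (fun n => Re (mu n - nu n)%C * t ^ n) 0 /\
    is_series (fun n => Im (mu n - nu n)%C * t ^ n) 0).
  { intros t Ht.
    pose proof (cseries_minus _ _ _ _ (Hmu t Ht) (Hnu t Ht)) as Hs.
    replace (f t - f t)%C with (RtoC 0) in Hs by ring.
    apply cseries_Re_Im in Hs; destruct Hs as [Hr Hi]; split.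
    - revert Hr; apply is_series_ext; intros k.
      rewrite <- RtoC_pow; destruct (mu k), (nu k); simpl; ring.
    - revert Hi; apply is_series_ext; intros k.
      rewrite <- RtoC_pow; destruct (mu k), (nu k); simpl; ring. }
  pose proof (real_pseries_zero _ d Hd (fun t Ht => proj1 (H t Ht)) n) as Er.
  pose proof (real_pseries_zero _ d Hd (fun t Ht => proj2 (H t Ht)) n) as Ei.
  simpl in Er, Ei; destruct (mu n), (nu n); simpl in *; f_equal; lra.
Qed.

(** * The space in terms of Taylor coefficients *)

(** The bound d stays strictly below c: this gap supplies the ratios < 1 used later. *)
Lemma LimSup_lt_eventually u c : Rbar_lt (LimSup_seq u) (Finite c) ->
  exists d N, d < c /\ forall n, (N <= n)%nat -> u n <= d.
Proof.
  intros H; pose proof (proj2_sig (ex_LimSup_seq u)) as Hs; fold (LimSup_seq u) in Hs.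
  destruct (LimSup_seq u) as [l | |]; simpl in H, Hs; [| easy |].
  - destruct (Hs (mkposreal ((c - l) / 2) ltac:(lra))) as [_ [N HN]].
    exists ((c + l) / 2), N; split; [lra|].
    intros n Hn; specialize (HN n Hn); simpl in HN; lra.
  - destruct (Hs (c - 1)) as [N HN]; exists (c - 1), N; split; [lra|].
    intros n Hn; left; now apply HN.
Qed.

Lemma eventually_le_bounded (u : nat -> R) N d : (forall n, (N <= n)%nat -> u n <= d) ->
  exists B, 0 <= B /\ forall n, u n <= B.
Proof.
  revert d; induction N as [|N IH]; intros d H.
  - exists (Rmax 0 d); split; [apply Rmax_l|].
    intros n; eapply Rle_trans; [apply H; lia | apply Rmax_r].
  - apply (IH (Rmax (u N) d)); intros n Hn.
    destruct (Nat.eq_dec n N) as [-> | Hne]; [apply Rmax_l|].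
    eapply Rle_trans; [apply H; lia | apply Rmax_r].
Qed.

Lemma sums_le_cons u B : 0 <= B -> sums_le u B ->
  sums_le (fun n => match n with O => 0 | S k => u k end) B.
Proof.
  intros HB Hu N; destruct N as [|N]; [rewrite sum_O; exact HB|].
  eapply Rle_trans; [|apply (Hu N)]; right.
  induction N as [|N IH].
  - rewrite sum_n_RS, !sum_O; lra.
  - rewrite sum_n_RS, IH, sum_n_RS; reflexivity.
Qed.

(** * Moduli estimates for I + S and its inverse *)

Section Recursion.
Variables (p : R) (beta : nat -> R).
Hypotheses (Hp : 1 < p) (Hbeta : forall n, 0 <= beta n).

(** Boundedness of I + S: [L] stands for the moduli of the coefficients [lam], [X] for those of the
    relative Taylor coefficients. *)
Lemma lp_convolve_bound c : (forall n, beta n <= c) ->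
  exists K, 0 <= K /\ forall X L : nat -> R,
    (forall n, 0 <= L n) -> (forall n, 0 <= X n) ->
    X 0%nat <= L 0%nat -> (forall n, X (S n) <= L (S n) + beta n * L n) ->
    forall B, sums_le (fun n => rpow (L n) p) B ->
      sums_le (fun n => rpow (X n) p) (K * B).
Proof.
  intros Hc.
  assert (Hc0 : 0 <= c) by (eapply Rle_trans; [apply (Hbeta 0) | apply Hc]).
  pose proof (rpow_ge0 2 p) as H2; pose proof (rpow_ge0 c p) as Hcp.
  exists (rpow 2 p * (1 + rpow c p)); split; [nra|].
  intros X L HL HX H0 HS B HB.
  assert (HB0 : 0 <= B)
    by (eapply Rle_trans; [apply sum_n_nneg | apply (HB 0%nat)]; intros; apply rpow_ge0).
  replace (rpow 2 p * (1 + rpow c p) * B) with (rpow 2 p * (B + rpow c p * B)) by ring.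
  eapply sums_le_mono; [|exact (sums_le_scal _ _ _ H2 (sums_le_plus _ _ _ _ HB
    (sums_le_scal _ _ _ Hcp (sums_le_cons _ _ HB0 HB))))].
  cbv beta.
  assert (H1 : 1 <= rpow 2 p).
  { rewrite rpow_pos by lra; rewrite <- (Rpower_O 2) by lra; apply Rle_Rpower; lra. }
  intros [|n].
  - pose proof (rpow_ge0 (L 0%nat) p).
    assert (rpow (X 0%nat) p <= rpow (L 0%nat) p) by (apply rpow_le; auto; lra).
    nra.
  - apply Rle_trans with (rpow (L (S n) + beta n * L n) p); [apply rpow_le; auto; lra|].
    assert (0 <= beta n * L n) by (apply Rmult_le_pos; auto).
    eapply Rle_trans; [apply rpow_add_le; auto; lra|].
    apply Rmult_le_compat_l; [exact H2|]; apply Rplus_le_compat_l.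
    rewrite rpow_mult by auto; apply Rmult_le_compat_r; [apply rpow_ge0|].
    apply rpow_le; auto; lra.
Qed.

(* The factor [r < 1] in front of [rpow (L n) p] (convexity) makes the recursion
   [L (n+1) <= X (n+1) + r L n] summable by absorption into the left-hand side. *)
Lemma lp_recursion_bound r N : 0 < r < 1 -> (forall n, (N <= n)%nat -> beta n <= r) ->
  exists K, 0 <= K /\ forall X L : nat -> R,
    (forall n, 0 <= L n) -> (forall n, 0 <= X n) ->
    L 0%nat <= X 0%nat -> (forall n, L (S n) <= X (S n) + beta n * L n) ->
    forall B, sums_le (fun n => rpow (X n) p) B ->
      sums_le (fun n => rpow (L n) p) (K * B).
Proof.
  intros Hr HN.
  pose (adm := fun X L : nat -> R => (forall n, 0 <= L n) /\ (forall n, 0 <= X n) /\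
    L 0%nat <= X 0%nat /\ (forall n, L (S n) <= X (S n) + beta n * L n)).
  (* Below N the weights are not controlled by r. A finite stretch still costs only a constant,
     which depends on the weights but not on [X] and [L]. *)
  assert (Hinit : forall M, exists K, 0 <= K /\ forall X L, adm X L ->
    forall B, sums_le (fun n => rpow (X n) p) B -> sum_n (fun n => rpow (L n) p) M <= K * B).
  { induction M as [|M [K [HK IH]]].
    - exists 1; split; [lra|]; intros X L [HL [HX [H0 HS]]] B HB.
      rewrite sum_O, Rmult_1_l; apply Rle_trans with (rpow (X 0%nat) p).
      + apply rpow_le; auto; lra.
      + apply (sums_le_term (fun n => rpow (X n) p)); [intros; apply rpow_ge0 | exact HB].
    - pose proof (rpow_ge0 2 p) as H2; pose proof (rpow_ge0 (beta M) p) as Hbp.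
      assert (H3 : 0 <= rpow (beta M) p * K) by now apply Rmult_le_pos.
      exists (K + rpow 2 p * (1 + rpow (beta M) p * K)); split; [nra|].
      intros X L HXL B HB; pose proof (IH X L HXL B HB) as HS'.
      destruct HXL as [HL [HX [H0 HS]]].
      rewrite sum_n_RS.
      assert (HXB : rpow (X (S M)) p <= B)
        by (apply (sums_le_term (fun n => rpow (X n) p)); [intros; apply rpow_ge0 | exact HB]).
      assert (HLB : rpow (L M) p <= K * B).
      { eapply Rle_trans; [|exact HS']; destruct M as [|M]; [rewrite sum_O; lra|].
        rewrite sum_n_RS.
        pose proof (sum_n_nneg (fun n => rpow (L n) p) M (fun n => rpow_ge0 _ _)); lra. }
      assert (Hstep : rpow (L (S M)) p <= rpow 2 p * (B + rpow (beta M) p * (K * B))).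
      { apply Rle_trans with (rpow (X (S M) + beta M * L M) p); [apply rpow_le; auto; lra|].
        assert (0 <= beta M * L M) by (apply Rmult_le_pos; auto).
        eapply Rle_trans; [apply rpow_add_le; auto; lra|].
        apply Rmult_le_compat_l; [exact H2|].
        rewrite rpow_mult by auto.
        apply Rplus_le_compat; [exact HXB|]; now apply Rmult_le_compat_l. }
      lra. }
  destruct (Hinit N) as [K0 [HK0 H0]].
  destruct (rpow_add_contract r p Hp Hr) as [K1 [HK1 H1]].
  exists (/ (1 - r) * (K0 + K1)); split.
  { apply Rmult_le_pos; [left; apply Rinv_0_lt_compat; lra | lra]. }
  intros X L HL HX HL0 HS B HB.
  specialize (H0 X L (conj HL (conj HX (conj HL0 HS))) B HB).
  assert (HSnn : forall n, 0 <= sum_n (fun n => rpow (L n) p) n)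
    by (intros n; apply sum_n_nneg; intros; apply rpow_ge0).
  assert (Hge : forall n, rpow (L n) p <= sum_n (fun n => rpow (L n) p) n).
  { intros [|n]; [rewrite sum_O; lra|].
    rewrite sum_n_RS; specialize (HSnn n); lra. }
  (* The bracket is the sum without its last term, so one induction step adds exactly r times the
     power of [L (N + j)]. *)
  assert (Hind : forall j, sum_n (fun n => rpow (L n) p) (N + j)
     <= K0 * B + K1 * sum_n (fun n => rpow (X n) p) (N + j)
        + r * (sum_n (fun n => rpow (L n) p) (N + j) - rpow (L (N + j)%nat) p)).
  { induction j as [|j IH].
    - rewrite Nat.add_0_r.
      assert (0 <= K1 * sum_n (fun n => rpow (X n) p) N)
        by (apply Rmult_le_pos; [exact HK1 | apply sum_n_nneg; intros; apply rpow_ge0]).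
      specialize (Hge N).
      assert (0 <= r * (sum_n (fun n => rpow (L n) p) N - rpow (L N) p))
        by (apply Rmult_le_pos; lra).
      lra.
    - rewrite Nat.add_succ_r, !sum_n_RS.
      assert (rpow (L (S (N + j))) p <= K1 * rpow (X (S (N + j))) p + r * rpow (L (N + j)%nat) p).
      { eapply Rle_trans; [|apply H1; auto].
        apply rpow_le; [lra | auto|].
        eapply Rle_trans; [apply HS|]; apply Rplus_le_compat_l, Rmult_le_compat_r; auto.
        apply HN; lia. }
      lra. }
  (* Absorption: r times the partial sum of [L] moves to the left, which is legitimate because the
     sum is finite. *)
  assert (Hfin : forall j, sum_n (fun n => rpow (L n) p) (N + j) <= / (1 - r) * (K0 + K1) * B).
  { intros j; specialize (Hind j); specialize (Hge (N + j)%nat).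
    pose proof (rpow_ge0 (L (N + j)%nat) p).
    pose proof (Rmult_le_compat_l K1 _ _ HK1 (HB (N + j)%nat)).
    apply (Rmult_le_reg_l (1 - r)); [lra|].
    replace ((1 - r) * (/ (1 - r) * (K0 + K1) * B)) with (K0 * B + K1 * B) by (field; lra).
    nra. }
  intros n; eapply Rle_trans; [|apply (Hfin n)]; rewrite Nat.add_comm.
  apply sum_n_incr; intros; apply rpow_ge0.
Qed.

End Recursion.

Lemma cseries_perturb (u v : nat -> C) l :
  (forall eps, 0 < eps ->
     exists N, forall n, (N <= n)%nat -> Cmod (sum_n u n - sum_n v n)%C < eps) ->
  cseries u l -> cseries v l.
Proof.
  intros Huv Hu; apply cseries_eps; intros eps Heps.
  destruct (Huv (eps / 2) ltac:(lra)) as [N1 H1].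
  destruct (proj1 (cseries_eps u l) Hu (eps / 2) ltac:(lra)) as [N2 H2].
  exists (N1 + N2)%nat; intros n Hn.
  specialize (H1 n ltac:(lia)); specialize (H2 n ltac:(lia)).
  replace (sum_n v n - l)%C with ((sum_n u n - l) + - (sum_n u n - sum_n v n))%C by ring.
  eapply Rle_lt_trans; [apply Cmod_triangle|]; rewrite Cmod_opp; lra.
Qed.

Section Space.
Variables (a b : nat -> C) (p : R).
Hypotheses (Hp : 1 < p) (Ha : forall n, a n <> RtoC 0).
Hypothesis Hrad :
  Rbar_lt (LimSup_seq (fun n => rpow (Cmod (a n) + Cmod (b n)) (/ INR n))) p_infty.
Hypothesis Hlim : Rbar_lt (LimSup_seq (fun n => Cmod (Cdiv (b n) (a (S n))))) (Finite 1).

Lemma in_disc_decay z : in_disc a b z ->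
  exists rho N, 0 <= rho < 1 /\
    forall n, (N <= n)%nat -> (Cmod (a n) + Cmod (b n)) * Cmod z ^ n <= rho ^ n.
Proof.
  intros Hz; unfold in_disc in Hz.
  pose proof (Cmod_ge_0 z) as Hz0; set (L := Lrad a b) in *.
  (* A number above the limsup with c |z| < 1; the denominator |z| + 1 covers z = 0. *)
  pose (c := L + (1 - Cmod z * L) / (2 * (Cmod z + 1))).
  assert (Hlt : Rbar_lt (LimSup_seq (fun n => rpow (Cmod (a n) + Cmod (b n)) (/ INR n)))
                        (Finite c)).
  { assert (Hpos : 0 < (1 - Cmod z * L) / (2 * (Cmod z + 1)))
      by (apply Rdiv_lt_0_compat; lra).
    unfold c, L, Lrad in *.
    destruct (LimSup_seq (fun n => rpow (Cmod (a n) + Cmod (b n)) (/ INR n)));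
      simpl in *; try easy; lra. }
  apply LimSup_lt_eventually in Hlt; destruct Hlt as [d [N [Hdc HN]]].
  assert (Hs : forall n, 0 < Cmod (a n) + Cmod (b n)).
  { intros n; pose proof (Cmod_gt_0 (a n)) as [H _]; specialize (H (Ha n)).
    pose proof (Cmod_ge_0 (b n)); lra. }
  assert (Hd : 0 < d).
  { eapply Rlt_le_trans; [|apply (HN N (Nat.le_refl N))]; now apply rpow_gt0. }
  (* Starting at [S N] forces n >= 1, where [/ INR n] is a true inverse. *)
  exists (d * Cmod z), (S N); split.
  - split; [nra|].
    apply Rle_lt_trans with (c * Cmod z); [nra|].
    unfold c.
    replace ((L + (1 - Cmod z * L) / (2 * (Cmod z + 1))) * Cmod z)
      with (Cmod z * L + (1 - Cmod z * L) * (Cmod z / (2 * (Cmod z + 1)))) by (field; lra).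
    assert (Cmod z / (2 * (Cmod z + 1)) < 1).
    { apply (Rmult_lt_reg_r (2 * (Cmod z + 1))); [lra|].
      unfold Rdiv; rewrite Rmult_assoc, Rinv_l by lra; lra. }
    nra.
  - intros n Hn; rewrite Rpow_mult_distr; apply Rmult_le_compat_r; [now apply pow_le|].
    specialize (HN n ltac:(lia)).
    assert (Hn0 : 0 < INR n) by (apply lt_0_INR; lia).
    rewrite <- (rpow_inv_l (Cmod (a n) + Cmod (b n)) (INR n)) by (specialize (Hs n); lra).
    rewrite <- Rpower_pow by assumption.
    rewrite <- (rpow_pos d) by assumption.
    apply rpow_le; [lra | apply rpow_ge0 | exact HN].
Qed.

Lemma in_disc_summable (x : nat -> C) B z : (forall n, Cmod (x n) <= B) -> in_disc a b z ->
  ex_series (fun n => Cmod (x n) * ((Cmod (a n) + Cmod (b n)) * Cmod z ^ n)).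
Proof.
  intros HB Hz; destruct (in_disc_decay z Hz) as [rho [N [Hr HN]]].
  assert (HB0 : 0 <= B) by (eapply Rle_trans; [apply Cmod_ge_0 | apply (HB 0%nat)]).
  apply (ex_series_incr_n _ N).
  apply ex_series_dom with (fun k => B * (rho ^ N * rho ^ k)).
  - intros k; split.
    + apply Rmult_le_pos; [apply Cmod_ge_0|].
      apply Rmult_le_pos; [|apply pow_le, Cmod_ge_0].
      pose proof (Cmod_ge_0 (a (N + k)%nat)); pose proof (Cmod_ge_0 (b (N + k)%nat)); lra.
    + rewrite <- pow_add; apply Rmult_le_compat; auto.
      * apply Cmod_ge_0.
      * apply Rmult_le_pos; [|apply pow_le, Cmod_ge_0].
        pose proof (Cmod_ge_0 (a (N + k)%nat)); pose proof (Cmod_ge_0 (b (N + k)%nat)); lra.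
      * apply HN; lia.
  - apply (ex_series_scal_l (V := R_NormedModule) B (fun k => rho ^ N * rho ^ k)).
    apply (ex_series_scal_l (V := R_NormedModule) (rho ^ N) (fun k => rho ^ k)).
    apply ex_series_geom; rewrite Rabs_pos_eq; lra.
Qed.

Lemma real_in_disc : exists d, 0 < d /\ forall t, Rabs t < d -> in_disc a b (RtoC t).
Proof.
  set (L := Lrad a b).
  assert (HL : 0 < Rabs L + 1) by (pose proof (Rabs_pos L); lra).
  exists (/ (Rabs L + 1)); split; [now apply Rinv_0_lt_compat|].
  intros t Ht; unfold in_disc; rewrite Cmod_R; fold L.
  apply Rle_lt_trans with (Rabs t * (Rabs L + 1)).
  - apply Rmult_le_compat_l; [apply Rabs_pos|]; pose proof (Rle_abs L); lra.
  - apply (Rmult_lt_compat_r _ _ _ HL) in Ht; rewrite Rinv_l in Ht; lra.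
Qed.

Definition pseries_of (mu : nat -> C) (f : C -> C) : Prop :=
  forall z, in_disc a b z -> cseries (fun n => Cmult (mu n) (Cpow z n)) (f z).

Lemma pseries_of_unique mu nu f : pseries_of mu f -> pseries_of nu f ->
  forall n, mu n = nu n.
Proof.
  intros Hmu Hnu; destruct real_in_disc as [d [Hd H]].
  apply (complex_pseries_unique mu nu (fun t => f (RtoC t)) d Hd);
    intros t Ht; [apply Hmu | apply Hnu]; auto.
Qed.

Lemma taylor_correct mu f : pseries_of mu f -> pseries_of (taylor a b f) f.
Proof.
  intros H; unfold taylor.
  apply (epsilon_spec (inhabits (fun _ : nat => RtoC 0)) (fun mu => pseries_of mu f)).
  now exists mu.
Qed.

Lemma taylor_eq mu f : pseries_of mu f -> forall n, taylor a b f n = mu n.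
Proof. intros H; apply pseries_of_unique with f; [now apply taylor_correct with mu | exact H]. Qed.

(** The Taylor coefficients of sum lam_n f_n: two neighbouring f_n contribute to each degree. *)
Definition mu_of (lam : nat -> C) (n : nat) : C :=
  match n with
  | O => Cmult (lam O) (a O)
  | S k => Cplus (Cmult (lam (S k)) (a (S k))) (Cmult (lam k) (b k))
  end.

(** Regrouping by degree leaves one boundary term, because f_N reaches degree N + 1. *)
Lemma sum_fn_mu_of lam z N :
  (sum_n (fun n => Cmult (lam n) (fn a b n z)) N
   - sum_n (fun n => Cmult (mu_of lam n) (Cpow z n)) N)%C
  = Cmult (Cmult (lam N) (b N)) (Cpow z (S N)).
Proof.
  induction N as [|N IH].
  - rewrite !sum_O; unfold fn, mu_of; rewrite Cpow_S; simpl; ring.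
  - rewrite !sum_n_CS.
    match goal with |- (?A + ?B - (?D + ?E))%C = _ =>
      replace (A + B - (D + E))%C with ((A - D) + (B - E))%C by ring end.
    rewrite IH; unfold fn, mu_of; rewrite !Cpow_S; ring.
Qed.

(** The boundary term of [sum_fn_mu_of] is dominated by |z| times the general term of a convergent
    series, so both series have the same sum. *)
Lemma represents_iff lam f B : (forall n, Cmod (lam n) <= B) ->
  represents a b lam f <-> pseries_of (mu_of lam) f.
Proof.
  intros HB.
  assert (Hsmall : forall z, in_disc a b z -> forall eps, 0 < eps -> exists N, forall n,
    (N <= n)%nat -> Cmod (Cmult (Cmult (lam n) (b n)) (Cpow z (S n))) < eps).
  { intros z Hz eps Heps.
    pose proof (in_disc_summable lam B z HB Hz) as Hex.
    apply ex_series_lim_0 in Hex; apply is_lim_seq_spec in Hex.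
    pose proof (Cmod_ge_0 z) as Hz0.
    assert (He : 0 < eps / (Cmod z + 1)) by (apply Rdiv_lt_0_compat; lra).
    destruct (Hex (mkposreal _ He)) as [N HN]; exists N; intros n Hn; specialize (HN n Hn).
    simpl in HN; rewrite Rminus_0_r in HN; apply Rle_lt_trans with (1 := Rle_abs _) in HN.
    rewrite !Cmod_mult, Cmod_pow; simpl.
    pose proof (Cmod_ge_0 (lam n)); pose proof (Cmod_ge_0 (a n)); pose proof (Cmod_ge_0 (b n)).
    pose proof (pow_le (Cmod z) n Hz0) as Hpw.
    apply Rle_lt_trans with
      (Cmod (lam n) * ((Cmod (a n) + Cmod (b n)) * Cmod z ^ n) * Cmod z).
    - replace (Cmod (lam n) * Cmod (b n) * (Cmod z * Cmod z ^ n))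
        with (Cmod (lam n) * (Cmod (b n) * Cmod z ^ n) * Cmod z) by ring.
      apply Rmult_le_compat_r; [lra|]; apply Rmult_le_compat_l; [lra|].
      apply Rmult_le_compat_r; lra.
    - set (s := Cmod (lam n) * ((Cmod (a n) + Cmod (b n)) * Cmod z ^ n)) in *.
      apply Rle_lt_trans with (eps / (Cmod z + 1) * Cmod z); [nra|].
      apply Rlt_le_trans with (eps / (Cmod z + 1) * (Cmod z + 1)); [nra|].
      right; field; lra. }
  split; intros H z Hz; specialize (H z Hz); revert H; apply cseries_perturb;
    intros eps Heps; destruct (Hsmall z Hz eps Heps) as [N HN]; exists N; intros n Hn.
  - rewrite sum_fn_mu_of; now apply HN.
  - rewrite <- Cmod_opp.
    match goal with |- Cmod (- (?A - ?D)) < _ => replace (- (A - D))%C with (D - A)%C by ring end.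
    rewrite sum_fn_mu_of; now apply HN.
Qed.

Lemma lp_bounded (x : nat -> C) B : sums_le (fun n => rpow (Cmod (x n)) p) B ->
  forall n, Cmod (x n) <= rpow B (/ p).
Proof.
  intros H n; rewrite <- (rpow_inv_r (Cmod (x n)) p) by (try apply Cmod_ge_0; lra).
  apply rpow_le; [left; apply Rinv_0_lt_compat; lra | apply rpow_ge0|].
  apply (sums_le_term (fun n => rpow (Cmod (x n)) p)); [intros; apply rpow_ge0 | exact H].
Qed.

Definition lp_sum (x : nat -> C) : R := Series (fun n => rpow (Cmod (x n)) p).

Definition rel_taylor (mu : nat -> C) (n : nat) : C := Cdiv (mu n) (a n).

Lemma coefs_correct f : inE a b p f -> in_lp p (coefs a b p f) /\ represents a b (coefs a b p f) f.
Proof.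
  intros H; unfold coefs.
  now apply (epsilon_spec (inhabits (fun _ : nat => RtoC 0))
              (fun lam => in_lp p lam /\ represents a b lam f)).
Qed.

(** I + S is bounded: the relative Taylor coefficients satisfy x_(n+1) = lam_(n+1) + (b_n / a_(n+1))
    lam_n. *)
Lemma rel_taylor_bound : exists K, 0 <= K /\ forall lam B,
  sums_le (fun n => rpow (Cmod (lam n)) p) B ->
  sums_le (fun n => rpow (Cmod (rel_taylor (mu_of lam) n)) p) (K * B).
Proof.
  destruct (LimSup_lt_eventually _ _ Hlim) as [d [N [Hd HN]]].
  destruct (eventually_le_bounded _ N d HN) as [c [Hc0 Hc]].
  destruct (lp_convolve_bound p (fun n => Cmod (Cdiv (b n) (a (S n)))) Hp
             (fun n => Cmod_ge_0 _) c Hc) as [K [HK H]].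
  exists K; split; [exact HK|]; intros lam B HB.
  apply (H (fun n => Cmod (rel_taylor (mu_of lam) n)) (fun n => Cmod (lam n)));
    try (intros; apply Cmod_ge_0); auto.
  - unfold rel_taylor; simpl; right; f_equal; field; apply Ha.
  - intros n; unfold rel_taylor; simpl.
    rewrite <- Cmod_mult.
    eapply Rle_trans; [|apply Cmod_triangle]; right; f_equal; field; apply Ha.
Qed.

(** The inverse of I + S is bounded: the same relation is solved for lam_(n+1) and fed to the
    recursion estimate. *)
Lemma lam_bound : exists K, 0 <= K /\ forall lam B,
  sums_le (fun n => rpow (Cmod (rel_taylor (mu_of lam) n)) p) B ->
  sums_le (fun n => rpow (Cmod (lam n)) p) (K * B).
Proof.
  destruct (LimSup_lt_eventually _ _ Hlim) as [d [N [Hd HN]]].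
  (* The bound d may be 0, while the convexity argument wants a ratio strictly between 0 and 1. *)
  assert (Hr : 0 < Rmax d (/ 2) < 1).
  { split; [eapply Rlt_le_trans; [|apply Rmax_r]; lra | apply Rmax_lub_lt; lra]. }
  destruct (lp_recursion_bound p (fun n => Cmod (Cdiv (b n) (a (S n)))) Hp
             (fun n => Cmod_ge_0 _) (Rmax d (/ 2)) N Hr) as [K [HK H]].
  { intros n Hn; eapply Rle_trans; [now apply HN | apply Rmax_l]. }
  exists K; split; [exact HK|]; intros lam B HB.
  apply (H (fun n => Cmod (rel_taylor (mu_of lam) n)) (fun n => Cmod (lam n)));
    try (intros; apply Cmod_ge_0); auto.
  - unfold rel_taylor; simpl; right; f_equal; field; apply Ha.
  - intros n; unfold rel_taylor; simpl.
    rewrite <- Cmod_mult, <- (Cmod_opp (Cmult (b n / a (S n)) (lam n))).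
    eapply Rle_trans; [|apply Cmod_triangle]; right; f_equal; field; apply Ha.
Qed.

Lemma inE_taylor : exists K, 0 <= K /\ forall f, inE a b p f ->
  pseries_of (taylor a b f) f /\
  sums_le (fun n => rpow (Cmod (rel_taylor (taylor a b f) n)) p) (K * lp_sum (coefs a b p f)).
Proof.
  destruct rel_taylor_bound as [K [HK H]]; exists K; split; [exact HK|].
  intros f Hf; destruct (coefs_correct f Hf) as [Hlp Hrep].
  set (lam := coefs a b p f) in *.
  assert (Hs : sums_le (fun n => rpow (Cmod (lam n)) p) (lp_sum lam))
    by (apply sums_le_Series; [intros; apply rpow_ge0 | exact Hlp]).
  apply (represents_iff lam f _ (lp_bounded lam _ Hs)) in Hrep.
  split; [now apply taylor_correct with (mu_of lam)|].
  eapply sums_le_mono; [|apply H, Hs].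
  intros n; unfold rel_taylor; rewrite (taylor_eq _ _ Hrep); apply Rle_refl.
Qed.

(** The solution of [mu_of lam = mu] by forward substitution. *)
Fixpoint lam_of (mu : nat -> C) (n : nat) : C :=
  match n with
  | O => Cdiv (mu O) (a O)
  | S k => Cdiv (Cminus (mu (S k)) (Cmult (lam_of mu k) (b k))) (a (S k))
  end.

Lemma mu_of_lam_of mu n : mu_of (lam_of mu) n = mu n.
Proof. destruct n; simpl; field; apply Ha. Qed.

Lemma inE_intro : exists K, 0 <= K /\ forall f mu B,
  pseries_of mu f -> sums_le (fun n => rpow (Cmod (rel_taylor mu n)) p) B ->
  inE a b p f /\ lp_sum (coefs a b p f) <= K * B.
Proof.
  destruct lam_bound as [K [HK H]]; exists K; split; [exact HK|].
  (* Used twice: for [lam_of mu], which proves membership, and for the chosen [coefs], whose [mu_of]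
     equals [mu] by uniqueness of Taylor coefficients. *)
  assert (Hext : forall lam mu B, (forall n, mu_of lam n = mu n) ->
     sums_le (fun n => rpow (Cmod (rel_taylor mu n)) p) B ->
     sums_le (fun n => rpow (Cmod (lam n)) p) (K * B)).
  { intros lam mu B E HB; apply H; eapply sums_le_mono; [|exact HB].
    intros n; unfold rel_taylor; rewrite E; apply Rle_refl. }
  intros f mu B Hf HB.
  assert (Hin : inE a b p f).
  { exists (lam_of mu); pose proof (Hext _ _ _ (mu_of_lam_of mu) HB) as Hl; split.
    - eapply sums_le_ex_series; [intros; apply rpow_ge0 | exact Hl].
    - apply (represents_iff _ f _ (lp_bounded _ _ Hl)).
      intros z Hz; generalize (Hf z Hz); apply cseries_ext.
      intros n; now rewrite mu_of_lam_of. }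
  split; [exact Hin|].
  destruct (coefs_correct f Hin) as [Hlp Hrep]; set (lam := coefs a b p f) in *.
  assert (Hs : sums_le (fun n => rpow (Cmod (lam n)) p) (lp_sum lam))
    by (apply sums_le_Series; [intros; apply rpow_ge0 | exact Hlp]).
  apply (represents_iff lam f _ (lp_bounded lam _ Hs)) in Hrep.
  apply sums_le_Series_le; [exact Hlp|].
  apply Hext with mu; [|exact HB].
  now apply pseries_of_unique with f.
Qed.

Lemma pseries_of_csum mu B : sums_le (fun n => rpow (Cmod (rel_taylor mu n)) p) B ->
  pseries_of mu (fun z => csum (fun n => Cmult (mu n) (Cpow z n))).
Proof.
  intros HB z Hz; apply csum_correct, cseries_of_abs.
  eapply ex_series_dom; [|apply (in_disc_summable (rel_taylor mu) _ z (lp_bounded _ _ HB) Hz)].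
  intros n; split; [apply Cmod_ge_0|].
  rewrite Cmod_mult, Cmod_pow, <- Rmult_assoc.
  apply Rmult_le_compat_r; [apply pow_le, Cmod_ge_0|].
  replace (mu n) with (rel_taylor mu n * a n)%C at 1
    by (unfold rel_taylor; field; apply Ha).
  rewrite Cmod_mult; apply Rmult_le_compat_l; [apply Cmod_ge_0|].
  pose proof (Cmod_ge_0 (b n)); lra.
Qed.

End Space.

(** * The dual space *)

Lemma sums_le_bound_nneg u B : (forall n, 0 <= u n) -> sums_le u B -> 0 <= B.
Proof. intros Hu HB; eapply Rle_trans; [apply Hu | apply (sums_le_term u B 0 Hu HB)]. Qed.

Lemma sum_n_eq0 (u : nat -> C) N :
  (forall n, (n <= N)%nat -> u n = 0%C) -> (sum_n u N : C) = RtoC 0.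
Proof.
  induction N as [|N IH]; intros Hu; [rewrite sum_O; now apply Hu|].
  rewrite sum_n_CS, IH, Hu by auto; apply Cplus_0_r.
Qed.

Lemma cseries_single (u : nat -> C) n : (forall k, k <> n -> u k = 0%C) -> cseries u (u n).
Proof.
  intros Hu; replace (u n) with (sum_n u n).
  - apply cseries_finite; intros k Hk; apply Hu; lia.
  - destruct n as [|n]; [now rewrite sum_O|].
    rewrite sum_n_CS, sum_n_eq0; [apply Cplus_0_l|].
    intros k Hk; apply Hu; lia.
Qed.

Lemma sum_n_RtoC (u : nat -> R) N : sum_n (fun n => RtoC (u n)) N = RtoC (sum_n u N).
Proof.
  induction N as [|N IH]; [now rewrite !sum_O|].
  now rewrite sum_n_CS, IH, sum_n_RS, RtoC_plus.
Qed.

(** Built one monomial at a time in the literal shape f + c g of [linearE], so that linearity of a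
    functional applies directly. The degrees run below N. *)
Fixpoint poly (mu : nat -> C) (N : nat) : C -> C :=
  match N with
  | O => fun _ => RtoC 0
  | S k => fun z => Cplus (poly mu k z) (Cmult (mu k) (Cpow z k))
  end.

Definition delta (n k : nat) : C := if (k =? n)%nat then RtoC 1 else RtoC 0.

Definition head (N : nat) (mu : nat -> C) (n : nat) : C :=
  if (n <? N)%nat then mu n else RtoC 0.

Lemma wprod_neq0 w n : (forall n, w n <> RtoC 0) -> wprod w n <> RtoC 0.
Proof.
  intros Hw; induction n as [|n IH]; simpl.
  - exact C1_nz.
  - now apply Cmult_neq_0.
Qed.

Section Dual.
Variables (a b w : nat -> C) (p q : R).
Hypotheses (Hp : 1 < p) (Hq : / p + / q = 1).
Hypotheses (Ha : forall n, a n <> RtoC 0) (Hw : forall n, w n <> RtoC 0).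
Hypothesis Hrad :
  Rbar_lt (LimSup_seq (fun n => rpow (Cmod (a n) + Cmod (b n)) (/ INR n))) p_infty.
Hypothesis Hsup : exists M, forall n, Cmod (Cdiv (Cmult (w n) (a n)) (a (S n))) <= M.
Hypothesis Hlim : Rbar_lt (LimSup_seq (fun n => Cmod (Cdiv (b n) (a (S n))))) (Finite 1).

Local Notation memE := (inE a b p).
Local Notation tayl := (taylor a b).
Local Notation powser := (pseries_of a b).
Local Notation relT := (rel_taylor a).
Local Notation lp_le s x B := (sums_le (fun n => rpow (Cmod (x n)) s) B).

Lemma conj_exponent_gt1 : 1 < q.
Proof.
  assert (Hip : 0 < / p < 1)
    by (split; [apply Rinv_0_lt_compat | rewrite <- Rinv_1; apply Rinv_lt_contravar]; lra).
  assert (Hiq : 0 < / q < 1) by lra.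
  rewrite <- (Rinv_inv q); rewrite <- Rinv_1 at 1; apply Rinv_lt_contravar; lra.
Qed.

Lemma pseries_of_lin mu nu f g c : powser mu f -> powser nu g ->
  powser (fun n => Cplus (mu n) (Cmult c (nu n))) (fun z => Cplus (f z) (Cmult c (g z))).
Proof.
  intros Hf Hg z Hz.
  generalize (cseries_plus _ _ _ _ (Hf z Hz) (cseries_scal c _ _ (Hg z Hz))).
  apply cseries_ext; intros n; ring.
Qed.

Lemma inE_pseries f : memE f -> powser (tayl f) f.
Proof.
  intros Hf; destruct (inE_taylor a b p Hp Ha Hrad Hlim) as [K [_ H]]; now apply H.
Qed.

Lemma inE_of_pseries mu f B : powser mu f -> lp_le p (relT mu) B -> memE f.
Proof.
  intros Hf HB; destruct (inE_intro a b p Hp Ha Hrad Hlim) as [K [_ H]].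
  now apply (H f mu B).
Qed.

Lemma inE_rel_taylor f : memE f -> exists B, lp_le p (relT (tayl f)) B.
Proof.
  intros Hf; destruct (inE_taylor a b p Hp Ha Hrad Hlim) as [K [_ H]].
  destruct (H f Hf) as [_ HB]; eexists; exact HB.
Qed.

Lemma lp_le_lin s x y c A B : 0 <= s -> lp_le s x A -> lp_le s y B ->
  lp_le s (fun n => Cplus (x n) (Cmult c (y n))) (rpow 2 s * (A + rpow (Cmod c) s * B)).
Proof.
  intros Hs HA HB.
  eapply sums_le_mono; [|exact (sums_le_scal _ _ _ (rpow_ge0 2 s)
    (sums_le_plus _ _ _ _ HA (sums_le_scal _ _ _ (rpow_ge0 (Cmod c) s) HB)))].
  intros n; cbv beta.
  rewrite <- rpow_mult, <- Cmod_mult by apply Cmod_ge_0.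
  eapply Rle_trans; [|apply rpow_add_le; auto; apply Cmod_ge_0].
  apply rpow_le; [exact Hs | apply Cmod_ge_0 | apply Cmod_triangle].
Qed.

Lemma inE_lin f g c : memE f -> memE g -> memE (fun z => Cplus (f z) (Cmult c (g z))).
Proof.
  intros Hf Hg.
  destruct (inE_rel_taylor f Hf) as [A HA]; destruct (inE_rel_taylor g Hg) as [B HB].
  eapply inE_of_pseries; [apply pseries_of_lin; apply inE_pseries; assumption|].
  eapply sums_le_mono; [|exact (lp_le_lin p _ _ c _ _ ltac:(lra) HA HB)].
  intros n; right; unfold rel_taylor; do 2 f_equal; field; apply Ha.
Qed.

Lemma taylor_lin f g c : memE f -> memE g ->
  forall n, tayl (fun z => Cplus (f z) (Cmult c (g z))) n
            = Cplus (tayl f n) (Cmult c (tayl g n)).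
Proof.
  intros Hf Hg; apply taylor_eq, pseries_of_lin; now apply inE_pseries.
Qed.

(** On relative Taylor coefficients the shift has weights w_n a_n / a_(n+1), which are bounded, so
    it preserves l^p. *)
Lemma Fw_correct f : memE f ->
  memE (Fw a b w f) /\ tayl (Fw a b w f) 0 = RtoC 0 /\
  forall n, tayl (Fw a b w f) (S n) = Cmult (tayl f n) (w n).
Proof.
  intros Hf; destruct (inE_rel_taylor f Hf) as [B HB]; destruct Hsup as [M HM].
  pose (nu := fun n => match n with O => RtoC 0 | S k => Cmult (tayl f k) (w k) end).
  assert (HM0 : 0 <= M) by (eapply Rle_trans; [apply Cmod_ge_0 | apply (HM 0%nat)]).
  assert (Hnu : exists B', lp_le p (relT nu) B').
  { assert (HB0 : 0 <= B) by (apply (sums_le_bound_nneg _ B (fun n => rpow_ge0 _ _) HB)).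
    eexists; eapply sums_le_mono; [|exact (sums_le_scal _ _ _ (rpow_ge0 M p)
      (sums_le_cons _ _ HB0 HB))].
    intros [|n]; unfold rel_taylor, nu.
    - unfold Cdiv; rewrite Cmult_0_l, Cmod_0, rpow_zero; lra.
    - fold (tayl f); rewrite <- rpow_mult by (try apply Cmod_ge_0; lra).
      apply rpow_le; [lra | apply Cmod_ge_0|].
      replace (tayl f n * w n / a (S n))%C
        with ((w n * a n / a (S n)) * (tayl f n / a n))%C by (field; split; apply Ha).
      rewrite Cmod_mult; apply Rmult_le_compat_r; [apply Cmod_ge_0 | apply HM]. }
  destruct Hnu as [B' HB'].
  assert (Hps : powser nu (Fw a b w f)).
  { intros z Hz.
    pose proof (cseries_uncons _ _ (pseries_of_csum a b p Hp Ha Hrad nu B' HB' z Hz)) as Hc.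
    assert (Hc' : cseries (fun n => Cmult (Cmult (tayl f n) (w n)) (Cpow z (S n)))
                          (Fw a b w f z)) by (apply csum_correct; eexists; exact Hc).
    apply (cseries_cons (fun n => Cmult (nu n) (Cpow z n))) in Hc'.
    replace (Fw a b w f z) with (nu 0%nat * Cpow z 0 + Fw a b w f z)%C
      by (unfold nu; ring).
    exact Hc'. }
  split; [now apply inE_of_pseries with nu B'|].
  split; [|intros n]; rewrite (taylor_eq _ _ _ _ Hps); reflexivity.
Qed.

Definition gam (n : nat) : C := Cdiv (a n) (wprod w n).

(* Functionals are parametrised by [U], their value on [z^n] being [U n / (w_0 ... w_(n-1))];
   in these coordinates the adjoint of the shift is the unweighted left shift of [U]. *)
Definition Rep (U : nat -> C) (phi : functional) : Prop :=
  forall f, memE f ->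
    cseries (fun n => Cdiv (Cmult (U n) (tayl f n)) (wprod w n)) (phi f).

(** The sequence paired with [rel_taylor]: its l^q norm is equivalent to the dual norm. *)
Definition scaled (U : nat -> C) (n : nat) : C := Cmult (U n) (gam n).

Lemma Rep_term U mu n :
  Cdiv (Cmult (U n) (mu n)) (wprod w n) = Cmult (relT mu n) (scaled U n).
Proof.
  unfold scaled, gam, rel_taylor; field; split;
    [now apply wprod_neq0 | apply Ha].
Qed.

Lemma scaled_lq_pairing U mu A B : 0 < B ->
  lp_le p (relT mu) A -> lp_le q (scaled U) B ->
  sums_le (fun n => Cmod (Cdiv (Cmult (U n) (mu n)) (wprod w n)))
          (rpow A (/ p) * rpow B (/ q)).
Proof.
  intros HB HA HU.
  assert (HA0 : 0 <= A) by (apply (sums_le_bound_nneg _ A (fun n => rpow_ge0 _ _) HA)).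
  apply sums_le_mono with (fun n => Cmod (relT mu n) * Cmod (scaled U n)).
  { intros n; rewrite Rep_term, Cmod_mult; apply Rle_refl. }
  destruct HA0 as [HA0 | <-].
  - apply holder_sums; auto; intros; apply Cmod_ge_0.
  (* A = 0 is outside [holder_sums], but then every relative coefficient vanishes. *)
  - rewrite rpow_zero, Rmult_0_l.
    intros N; right; induction N as [|N IH].
    + rewrite sum_O.
      pose proof (lp_bounded p Hp _ _ HA 0) as H0; rewrite rpow_zero in H0.
      pose proof (Cmod_ge_0 (relT mu 0)).
      replace (Cmod (relT mu 0)) with 0 by lra; ring.
    + rewrite sum_n_RS, IH.
      pose proof (lp_bounded p Hp _ _ HA (S N)) as H0; rewrite rpow_zero in H0.
      pose proof (Cmod_ge_0 (relT mu (S N))).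
      replace (Cmod (relT mu (S N))) with 0 by lra; ring.
Qed.

(** K comes from the norm equivalence and is uniform in [U], so a small l^q sum gives a small dual
    norm. *)
Lemma Rep_bound : exists K, 0 <= K /\ forall U phi B, 0 < B -> Rep U phi ->
  lp_le q (scaled U) B ->
  forall f, memE f -> Cmod (phi f) <= K * rpow B (/ q) * normE a b p f.
Proof.
  destruct (inE_taylor a b p Hp Ha Hrad Hlim) as [K [HK H]].
  exists (rpow K (/ p)); split; [apply rpow_ge0|].
  intros U phi B HB HR HU f Hf; destruct (H f Hf) as [_ HA].
  eapply cseries_Cmod_le; [apply (HR f Hf)|].
  pose proof (scaled_lq_pairing U (tayl f) _ B HB HA HU) as Hs.
  replace (rpow K (/ p) * rpow B (/ q) * normE a b p f)
    with (rpow (K * lp_sum p (coefs a b p f)) (/ p) * rpow B (/ q)); [exact Hs|].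
  rewrite rpow_mult; [unfold normE, lp_sum; ring | exact HK|].
  apply Series_nneg; [intros; apply rpow_ge0 | now apply coefs_correct].
Qed.

Lemma Rep_linear U phi : Rep U phi -> linearE a b p phi.
Proof.
  intros HR f g c Hf Hg.
  eapply cseries_unique; [apply (HR _ (inE_lin f g c Hf Hg))|].
  generalize (cseries_plus _ _ _ _ (HR f Hf) (cseries_scal c _ _ (HR g Hg))).
  apply cseries_ext; intros n; rewrite taylor_lin by assumption.
  field; now apply wprod_neq0.
Qed.

Lemma Rep_inDual U phi B : Rep U phi -> lp_le q (scaled U) B -> inDual a b p phi.
Proof.
  intros HR HB; split; [now apply Rep_linear with U|].
  assert (HB0 : 0 <= B) by (apply (sums_le_bound_nneg _ B (fun n => rpow_ge0 _ _) HB)).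
  destruct Rep_bound as [K [HK H]].
  exists (K * rpow (B + 1) (/ q)); intros f Hf; apply H with U; auto; [lra|].
  intros N; specialize (HB N); lra.
Qed.

Lemma Rep_exists U B : lp_le q (scaled U) B -> exists phi, Rep U phi.
Proof.
  intros HB.
  assert (HB0 : 0 <= B) by (apply (sums_le_bound_nneg _ B (fun n => rpow_ge0 _ _) HB)).
  assert (HB1 : lp_le q (scaled U) (B + 1)) by (intros N; specialize (HB N); lra).
  exists (fun f => csum (fun n => Cdiv (Cmult (U n) (tayl f n)) (wprod w n))).
  intros f Hf; apply csum_correct, cseries_of_abs.
  destruct (inE_rel_taylor f Hf) as [A HA].
  eapply sums_le_ex_series; [intros; apply Cmod_ge_0|].
  apply (scaled_lq_pairing U (tayl f) A (B + 1)); auto; lra.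
Qed.

Lemma Rep_dnorm_lt eps : 0 < eps -> exists d, 0 < d /\
  forall U phi, Rep U phi -> lp_le q (scaled U) d -> dnorm_lt a b p phi eps.
Proof.
  intros Heps; destruct Rep_bound as [K [HK H]].
  pose proof conj_exponent_gt1 as Hq1.
  assert (He : 0 < eps / (K + 1)) by (apply Rdiv_lt_0_compat; lra).
  (* K times the q-th root of this number is K eps / (K + 1), strictly below eps even when K = 0. *)
  exists (rpow (eps / (K + 1)) q); split; [now apply rpow_gt0|].
  intros U phi HR HU; exists (K * (eps / (K + 1))); split; [apply Rmult_le_pos; lra|].
  split.
  - apply (Rmult_lt_reg_r (K + 1)); [lra|].
    replace (K * (eps / (K + 1)) * (K + 1)) with (K * eps) by (field; lra); nra.
  - intros f Hf; rewrite <- (rpow_inv_r (eps / (K + 1)) q) by lra.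
    apply H with U; auto; now apply rpow_gt0.
Qed.

(** Coefficient n + 1 of F_w f is w_n times coefficient n of f, and w_n cancels the last factor of
    [wprod w (S n)]; the constant coefficient is 0 and drops out. *)
Lemma Rep_shift U phi : Rep U phi -> Rep (fun n => U (S n)) (Fwstar a b w phi).
Proof.
  intros HR f Hf; destruct (Fw_correct f Hf) as [Hin [H0 HS]].
  pose proof (cseries_uncons _ _ (HR _ Hin)) as Hc; unfold Fwstar; cbv beta in Hc.
  rewrite H0 in Hc.
  replace (phi (Fw a b w f)) with (phi (Fw a b w f) - U 0%nat * 0 / wprod w 0)%C
    by (simpl; field; exact C1_nz).
  revert Hc; apply cseries_ext; intros n; rewrite HS; simpl.
  field; split; [now apply wprod_neq0 | apply Hw].
Qed.

Lemma Rep_iter U phi m : Rep U phi ->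
  Rep (fun n => U (n + m)%nat) (Nat.iter m (Fwstar a b w) phi).
Proof.
  intros HR; induction m as [|m IH].
  - intros f Hf; generalize (HR f Hf); apply cseries_ext; intros n; now rewrite Nat.add_0_r.
  - intros f Hf; generalize (Rep_shift _ _ IH f Hf); apply cseries_ext.
    intros n; now replace (S n + m)%nat with (n + S m)%nat by lia.
Qed.

Lemma Rep_fsub U V phi psi : Rep U phi -> Rep V psi ->
  Rep (fun n => Cminus (U n) (V n)) (fsub phi psi).
Proof.
  intros HU HV f Hf; generalize (cseries_minus _ _ _ _ (HU f Hf) (HV f Hf)).
  apply cseries_ext; intros n; field; now apply wprod_neq0.
Qed.

(** * Monomials and polynomials as test functions *)

Lemma monomial_pseries n : powser (delta n) (fun z => Cpow z n).
Proof.
  intros z Hz.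
  replace (Cpow z n) with (delta n n * Cpow z n)%C
    by (unfold delta; rewrite Nat.eqb_refl; ring).
  apply (cseries_single (fun k => Cmult (delta n k) (Cpow z k))).
  intros k Hk; unfold delta; apply Nat.eqb_neq in Hk; rewrite Hk; ring.
Qed.

Lemma poly_pseries mu N : powser (head N mu) (poly mu N).
Proof.
  induction N as [|N IH]; intros z Hz.
  - simpl; replace (RtoC 0) with (head 0 mu 0 * Cpow z 0)%C at 1 by (unfold head; simpl; ring).
    apply (cseries_single (fun n => Cmult (head 0 mu n) (Cpow z n))).
    intros k _; unfold head; simpl; ring.
  - simpl.
    generalize (pseries_of_lin _ _ _ _ (mu N) IH (monomial_pseries N) z Hz).
    apply cseries_ext; intros n; f_equal; unfold head, delta.
    destruct (Nat.eqb_spec n N) as [-> |].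
    + rewrite Nat.ltb_irrefl; replace (N <? S N)%nat with true
        by (symmetry; apply Nat.ltb_lt; lia); ring.
    + destruct (Nat.ltb_spec n N), (Nat.ltb_spec n (S N)); try lia; ring.
Qed.

Lemma head_lp_le mu s N : lp_le s (relT (head (S N) mu))
  (sum_n (fun n => rpow (Cmod (relT mu n)) s) N).
Proof.
  assert (Hle : forall M, (M <= N)%nat ->
    sum_n (fun n => rpow (Cmod (relT (head (S N) mu) n)) s) M
    = sum_n (fun n => rpow (Cmod (relT mu n)) s) M).
  { assert (Hh : forall n, (n <= N)%nat -> relT (head (S N) mu) n = relT mu n).
    { intros n Hn; unfold rel_taylor, head.
      now replace (n <? S N)%nat with true by (symmetry; apply Nat.ltb_lt; lia). }
    induction M as [|M IH]; intros HM; [rewrite !sum_O; now rewrite Hh by lia|].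
    rewrite !sum_n_RS, IH, Hh by lia; reflexivity. }
  assert (Hge : forall j, sum_n (fun n => rpow (Cmod (relT (head (S N) mu) n)) s) (N + j)
    = sum_n (fun n => rpow (Cmod (relT mu n)) s) N).
  { induction j as [|j IH]; [rewrite Nat.add_0_r; now apply Hle|].
    rewrite Nat.add_succ_r, sum_n_RS, IH.
    unfold rel_taylor, head.
    replace (S (N + j) <? S N)%nat with false by (symmetry; apply Nat.ltb_ge; lia).
    unfold Cdiv; rewrite Cmult_0_l, Cmod_0, rpow_zero; apply Rplus_0_r. }
  intros M; rewrite <- (Hge M), Nat.add_comm.
  apply sum_n_incr; intros; apply rpow_ge0.
Qed.

Lemma poly_inE mu N : memE (poly mu N).
Proof.
  destruct N as [|N].
  - apply inE_of_pseries with (head 0 mu) 0; [apply poly_pseries|].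
    intros N; right; induction N as [|N IH]; rewrite ?sum_O, ?sum_n_RS, ?IH;
      unfold rel_taylor, head; simpl; unfold Cdiv;
      rewrite Cmult_0_l, Cmod_0, rpow_zero; lra.
  - eapply inE_of_pseries; [apply poly_pseries | apply head_lp_le].
Qed.

Lemma monomial_inE n : memE (fun z => Cpow z n).
Proof.
  apply inE_of_pseries with (delta n) (sum_n (fun k => rpow (Cmod (relT (delta n) k)) p) n);
    [apply monomial_pseries|].
  eapply sums_le_mono; [|apply (head_lp_le (delta n) p n)].
  intros k; right; do 2 f_equal; unfold rel_taylor, head, delta.
  destruct (Nat.ltb_spec k (S n)); [reflexivity|].
  now replace (k =? n)%nat with false by (symmetry; apply Nat.eqb_neq; lia).
Qed.

Lemma Rep_monomial U phi n : Rep U phi -> phi (fun z => Cpow z n) = Cdiv (U n) (wprod w n).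
Proof.
  intros HR; eapply cseries_unique; [apply (HR _ (monomial_inE n))|].
  set (u := fun k => _).
  replace (Cdiv (U n) (wprod w n)) with (u n).
  - apply cseries_single; intros k Hk; unfold u.
    rewrite (taylor_eq _ _ _ _ (monomial_pseries n)); unfold delta.
    apply Nat.eqb_neq in Hk; rewrite Hk; field; now apply wprod_neq0.
  - unfold u; rewrite (taylor_eq _ _ _ _ (monomial_pseries n)); unfold delta.
    rewrite Nat.eqb_refl; field; now apply wprod_neq0.
Qed.

(** Evaluation at monomials recovers the sequence; this turns a periodic functional into a periodic
    sequence. *)
Lemma Rep_inj U V phi psi : Rep U phi -> Rep V psi -> (forall f, memE f -> phi f = psi f) ->
  forall n, U n = V n.
Proof.
  intros HU HV E n.
  pose proof (E _ (monomial_inE n)) as En.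
  rewrite (Rep_monomial U phi n HU), (Rep_monomial V psi n HV) in En.
  replace (U n) with (U n / wprod w n * wprod w n)%C by (field; now apply wprod_neq0).
  rewrite En; field; now apply wprod_neq0.
Qed.

(** * Every bounded functional is given by a sequence *)

Lemma inDual_bound phi : inDual a b p phi -> exists M, 0 <= M /\ forall f mu A,
  powser mu f -> lp_le p (relT mu) A -> Cmod (phi f) <= M * rpow A (/ p).
Proof.
  intros [_ [M0 HM0]].
  destruct (inE_intro a b p Hp Ha Hrad Hlim) as [K [HK H]].
  exists (Rmax 0 M0 * rpow K (/ p)); split.
  { apply Rmult_le_pos; [apply Rmax_l | apply rpow_ge0]. }
  intros f mu A Hf HA; destruct (H f mu A Hf HA) as [Hin Hle].
  assert (HA0 : 0 <= A) by (apply (sums_le_bound_nneg _ A (fun n => rpow_ge0 _ _) HA)).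
  eapply Rle_trans; [apply HM0, Hin|].
  rewrite Rmult_assoc, <- rpow_mult by assumption.
  unfold normE; apply Rle_trans with (Rmax 0 M0 * rpow (lp_sum p (coefs a b p f)) (/ p)).
  - apply Rmult_le_compat_r; [apply rpow_ge0 | apply Rmax_r].
  - apply Rmult_le_compat_l; [apply Rmax_l|].
    apply rpow_le; [left; apply Rinv_0_lt_compat; lra | | exact Hle].
    apply Series_nneg; [intros; apply rpow_ge0 | now apply coefs_correct].
Qed.

Lemma inDual_poly phi mu N : inDual a b p phi ->
  phi (poly mu (S N)) = sum_n (fun n => Cmult (mu n) (phi (fun z => Cpow z n))) N.
Proof.
  intros Hphi.
  assert (Hstep : forall N, phi (poly mu (S N))
     = Cplus (phi (poly mu N)) (Cmult (mu N) (phi (fun z => Cpow z N)))).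
  { intros k; apply (proj1 Hphi); [apply poly_inE | apply monomial_inE]. }
  induction N as [|N IH]; rewrite Hstep.
  - rewrite sum_O.
    destruct (inDual_bound phi Hphi) as [M [HM H]].
    (* The empty polynomial is sent to 0 because its relative coefficients have l^p sum 0. *)
    assert (Hz : Cmod (phi (poly mu 0)) <= M * rpow 0 (/ p)).
    { apply H with (head 0 mu); [apply poly_pseries|].
      intros N; right; induction N as [|N IH]; rewrite ?sum_O, ?sum_n_RS, ?IH;
        unfold rel_taylor, head; simpl; unfold Cdiv;
        rewrite Cmult_0_l, Cmod_0, rpow_zero; lra. }
    rewrite rpow_zero, Rmult_0_r in Hz.
    replace (phi (poly mu 0)) with (RtoC 0); [apply Cplus_0_l|].
    symmetry; apply Cmod_eq_0; pose proof (Cmod_ge_0 (phi (poly mu 0))); lra.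
  - rewrite IH, sum_n_CS; reflexivity.
Qed.

(* Testing [phi] on the polynomials with relative coefficients [conj y |y|^(q-2)]
   is the equality case of Hölder's inequality. *)
Lemma inDual_lq phi : inDual a b p phi ->
  exists B, lp_le q (fun n => Cmult (a n) (phi (fun z => Cpow z n))) B.
Proof.
  intros Hphi; pose proof conj_exponent_gt1 as Hq1.
  destruct (inDual_bound phi Hphi) as [M [HM H]].
  pose (y := fun n => Cmult (a n) (phi (fun z => Cpow z n))).
  pose (mu := fun n => Cmult (a n) (Cmult (Cconj (y n)) (RtoC (rpow (Cmod (y n)) (q - 2))))).
  exists (rpow M q); intros N.
  pose (S' := sum_n (fun n => rpow (Cmod (y n)) q) N); change (S' <= rpow M q).
  assert (HS0 : 0 <= S') by (apply sum_n_nneg; intros; apply rpow_ge0).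
  (* At x = 0 both sides are 0 even for q < 2, so zeros of [y] need no separate treatment. *)
  assert (Hsplit : forall x, 0 <= x -> rpow x q = x ^ 2 * rpow x (q - 2)).
  { intros x Hx; replace q with (1 + (1 + (q - 2))) at 1 by ring.
    rewrite !rpow_plus, rpow_1_r by assumption; ring. }
  assert (Hval : phi (poly mu (S N)) = RtoC S').
  { rewrite inDual_poly by assumption; unfold S'; rewrite <- sum_n_RtoC.
    apply sum_n_ext; intros n; match goal with |- ?l = ?r => change (@eq C l r) end.
    rewrite (Hsplit (Cmod (y n)) (Cmod_ge_0 _)), RtoC_mult, Cmod2_conj.
    unfold mu.
    replace (a n * (Cconj (y n) * rpow (Cmod (y n)) (q - 2)) * phi (fun z : C => Cpow z n))%C
      with (y n * (Cconj (y n) * rpow (Cmod (y n)) (q - 2)))%C by (unfold y; ring).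
    ring. }
  (* The exponent identity is (q - 1) p = q. *)
  assert (Hmu : forall n, rpow (Cmod (relT mu n)) p = rpow (Cmod (y n)) q).
  { intros n; unfold rel_taylor, mu.
    replace (a n * (Cconj (y n) * rpow (Cmod (y n)) (q - 2)) / a n)%C
      with (Cconj (y n) * rpow (Cmod (y n)) (q - 2))%C by (field; apply Ha).
    rewrite Cmod_mult, Cmod_conj, Cmod_R, Rabs_pos_eq by apply rpow_ge0.
    rewrite <- (rpow_1_r (Cmod (y n))) at 1 by apply Cmod_ge_0.
    rewrite <- rpow_plus, rpow_rpow by apply Cmod_ge_0; f_equal.
    replace (1 + (q - 2)) with (q - 1) by ring.
    apply (Rmult_eq_reg_r (/ p * / q)).
    - replace ((q - 1) * p * (/ p * / q)) with (1 - / q) by (field; lra).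
      replace (q * (/ p * / q)) with (/ p) by (field; lra); lra.
    - apply Rgt_not_eq, Rmult_lt_0_compat; apply Rinv_0_lt_compat; lra. }
  assert (Hle : S' <= M * rpow S' (/ p)).
  { replace S' with (Cmod (phi (poly mu (S N)))) at 1
      by (rewrite Hval, Cmod_R; now apply Rabs_pos_eq).
    apply H with (head (S N) mu); [apply poly_pseries|].
    unfold S'; rewrite <- (sum_n_ext _ _ N Hmu); apply head_lp_le. }
  (* For S' > 0, division of S' <= M S'^(1/p) by S'^(1/p) leaves S'^(1/q) <= M, uniformly in N. *)
  destruct HS0 as [HS0 | <-]; [|apply rpow_ge0].
  rewrite <- (rpow_inv_l S' q) by lra.
  apply rpow_le; [lra | apply rpow_ge0|].
  apply (Rmult_le_reg_r (rpow S' (/ p))); [now apply rpow_gt0|].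
  rewrite <- rpow_plus, (Rplus_comm (/ q)), Hq, rpow_1_r by lra; exact Hle.
Qed.

(** The Taylor polynomials converge to f in norm, since the tails of the relative coefficients tend
    to 0 in l^p; hence phi is the sum of its values on the monomials. *)
Lemma inDual_Rep phi : inDual a b p phi -> exists U B, Rep U phi /\ lp_le q (scaled U) B.
Proof.
  intros Hphi; destruct (inDual_lq phi Hphi) as [B HB].
  exists (fun n => Cmult (phi (fun z => Cpow z n)) (wprod w n)), B; split.
  - intros f Hf.
    apply cseries_ext with (fun n => Cmult (tayl f n) (phi (fun z => Cpow z n))).
    { intros n; field; now apply wprod_neq0. }
    destruct (inDual_bound phi Hphi) as [M [HM H]].
    apply cseries_eps; intros eps Heps.
    assert (He : 0 < eps / (M + 1)) by (apply Rdiv_lt_0_compat; lra).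
    destruct (inE_rel_taylor f Hf) as [A HA].
    destruct (sums_le_tail (fun n => rpow (Cmod (relT (tayl f) n)) p)
                (rpow (eps / (M + 1)) p)) as [N HN].
    { apply sums_le_ex_series with A; [intros; apply rpow_ge0 | exact HA]. }
    { now apply rpow_gt0. }
    exists N; intros n Hn; rewrite <- inDual_poly by assumption.
    (* The difference is written as f + (-1) g to match [linearE]. *)
    replace (phi (poly (tayl f) (S n)) - phi f)%C
      with (- (phi f + Copp (RtoC 1) * phi (poly (tayl f) (S n))))%C
      by ring.
    rewrite Cmod_opp, <- (proj1 Hphi) by (try apply poly_inE; assumption).
    apply Rle_lt_trans with (M * rpow (rpow (eps / (M + 1)) p) (/ p)).
    + eapply H; [apply pseries_of_lin; [now apply inE_pseries | apply poly_pseries]|].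
      eapply sums_le_mono; [|apply (HN (S n)); lia].
      intros k; unfold tail, rel_taylor, head; fold (tayl f).
      destruct (k <? S n)%nat.
      * replace ((tayl f k + Copp (RtoC 1) * tayl f k) / a k)%C with (RtoC 0)
          by (field; apply Ha).
        rewrite Cmod_0, rpow_zero; apply Rle_refl.
      * right; do 2 f_equal; field; apply Ha.
    + rewrite rpow_inv_r by lra.
      apply (Rmult_lt_reg_r (M + 1)); [lra|].
      replace (M * (eps / (M + 1)) * (M + 1)) with (M * eps) by (field; lra); nra.
  - eapply sums_le_mono; [|exact HB]; intros n; right; do 2 f_equal.
    unfold scaled, gam; field; now apply wprod_neq0.
Qed.

End Dual.

(** * A universal sequence *)

Lemma fun_choice {A B : Type} (P : A -> B -> Prop) :
  (forall x, exists y, P x y) -> exists f, forall x, P x (f x).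
Proof.
  intros H; exists (fun x => proj1_sig (constructive_indefinite_description _ (H x))).
  intros x; apply proj2_sig.
Qed.

Definition rat_code (n : nat) : R :=
  let (i, m) := Cantor.of_nat n in
  let (j, k) := Cantor.of_nat m in (INR i - INR j) / INR (S k).

Lemma rat_code_dense x eps : 0 < eps -> exists n, Rabs (rat_code n - x) < eps.
Proof.
  intros Heps; destruct (archimed_cor1 eps Heps) as [k [Hk Hk0]].
  destruct k as [|k]; [lia|].
  assert (HS : 0 < INR (S k)) by (apply lt_0_INR; lia).
  destruct (archimed (x * INR (S k))) as [H1 H2].
  set (z := up (x * INR (S k))) in *.
  exists (Cantor.to_nat (Z.to_nat z, Cantor.to_nat (Z.to_nat (- z), k))).
  unfold rat_code; rewrite !Cantor.cancel_of_to.
  assert (Ez : INR (Z.to_nat z) - INR (Z.to_nat (- z)) = IZR z).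
  { rewrite !INR_IZR_INZ, <- minus_IZR; f_equal; lia. }
  rewrite Ez.
  replace (IZR z / INR (S k) - x) with ((IZR z - x * INR (S k)) * / INR (S k))
    by (field; lra).
  pose proof (Rinv_0_lt_compat _ HS).
  rewrite Rabs_pos_eq by (apply Rmult_le_pos; lra).
  apply Rle_lt_trans with (1 * / INR (S k)); [apply Rmult_le_compat_r; lra | lra].
Qed.

Definition crat_code (n : nat) : C :=
  let (i, j) := Cantor.of_nat n in (rat_code i, rat_code j).

Lemma crat_code_dense z eps : 0 < eps -> exists n, Cmod (crat_code n - z)%C <= eps.
Proof.
  intros Heps; destruct z as [x y].
  destruct (rat_code_dense x (eps / 2) ltac:(lra)) as [i Hi].
  destruct (rat_code_dense y (eps / 2) ltac:(lra)) as [j Hj].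
  exists (Cantor.to_nat (i, j)); unfold crat_code; rewrite Cantor.cancel_of_to.
  replace ((rat_code i, rat_code j) - (x, y))%C
    with (RtoC (rat_code i - x) + Ci * RtoC (rat_code j - y))%C
    by (unfold Ci, RtoC, Cminus, Cplus, Cmult, Copp; simpl; f_equal; ring).
  eapply Rle_trans; [apply Cmod_triangle|].
  rewrite Cmod_mult, !Cmod_R.
  replace (Cmod Ci) with 1
    by (unfold Ci, Cmod; simpl; symmetry; etransitivity; [|apply sqrt_1]; f_equal; ring).
  lra.
Qed.

(** Repeated Cantor unpairing reads one natural number as an endless stream of digits; any finite
    sequence occurs as a prefix. *)
Definition digit (code i : nat) : nat :=
  fst (Cantor.of_nat (Nat.iter i (fun m => snd (Cantor.of_nat m)) code)).

Lemma digit_surj (s : nat -> nat) len : exists code, forall i, (i < len)%nat -> digit code i = s i.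
Proof.
  revert s; induction len as [|len IH]; intros s; [exists 0%nat; lia|].
  destruct (IH (fun i => s (S i))) as [code Hc].
  exists (Cantor.to_nat (s 0%nat, code)); intros [|i] Hi; unfold digit.
  - change (fst (Cantor.of_nat (Cantor.to_nat (s 0%nat, code))) = s 0%nat).
    now rewrite Cantor.cancel_of_to.
  - rewrite Nat.iter_succ_r, Cantor.cancel_of_to; apply Hc; lia.
Qed.

(** The clause [K <= k] answers the error 2^-k of [universal_sequence]: each target must be
    approximated at arbitrarily late indices. *)
Lemma finite_seqs_dense : exists Y : nat -> nat -> C,
  (forall k, exists d, forall i, (d <= i)%nat -> Y k i = RtoC 0) /\
  forall Z N eta K, 0 < eta -> exists k, (K <= k)%nat /\
    (forall i, (i < N)%nat -> Cmod (Y k i - Z i)%C <= eta) /\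
    (forall i, (N <= i)%nat -> Y k i = RtoC 0).
Proof.
  (* the first Cantor component of [k] is ignored, so that every sequence recurs *)
  exists (fun k i => let (len, code) := Cantor.of_nat (snd (Cantor.of_nat k)) in
            if (i <? len)%nat then crat_code (digit code i) else RtoC 0); split.
  - intros k; destruct (Cantor.of_nat (snd (Cantor.of_nat k))) as [len code].
    exists len; intros i Hi; apply Nat.ltb_ge in Hi; now rewrite Hi.
  - intros Z N eta K Heta.
    destruct (fun_choice _ (fun i => crat_code_dense (Z i) eta Heta)) as [s Hs].
    destruct (digit_surj s N) as [code Hc].
    exists (Cantor.to_nat (K, Cantor.to_nat (N, code))).
    rewrite Cantor.cancel_of_to; cbn [snd]; rewrite Cantor.cancel_of_to; split; [|split].
    + pose proof (Cantor.to_nat_non_decreasing K (Cantor.to_nat (N, code))); lia.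
    + intros i Hi; rewrite (proj2 (Nat.ltb_lt i N) Hi), (Hc i Hi); apply Hs.
    + intros i Hi; apply Nat.ltb_ge in Hi; now rewrite Hi.
Qed.

(** * Cutting the indices into consecutive blocks *)

Section Blocks.
Variable n : nat -> nat.
Hypothesis Hn : forall k, (n k < n (S k))%nat.

Lemma starts_mono j k : (j <= k)%nat -> (n j <= n k)%nat.
Proof. induction 1 as [|k _ IH]; [lia | pose proof (Hn k); lia]. Qed.

Lemma starts_add j k : (n j + k <= n (j + k))%nat.
Proof.
  induction k as [|k IH]; [rewrite !Nat.add_0_r; lia|].
  rewrite !Nat.add_succ_r; pose proof (Hn (j + k)); lia.
Qed.

Hypothesis Hn0 : n 0%nat = 0%nat.

(** The number of the block containing i. The starts increase strictly, so passing from i to i + 1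
    crosses at most one of them. *)
Fixpoint block (i : nat) : nat :=
  match i with
  | O => O
  | S j => if (n (S (block j)) <=? S j)%nat then S (block j) else block j
  end.

Lemma block_bounds i : (n (block i) <= i < n (S (block i)))%nat.
Proof.
  induction i as [|i IH]; simpl.
  - pose proof (Hn 0); lia.
  - destruct (Nat.leb_spec (n (S (block i))) (S i)); [|lia].
    pose proof (Hn (S (block i))); lia.
Qed.

Lemma block_unique i k : (n k <= i < n (S k))%nat -> block i = k.
Proof.
  intros Hk; pose proof (block_bounds i) as Hb.
  destruct (Nat.lt_trichotomy (block i) k) as [Hlt | [Heq | Hlt]]; [|exact Heq|].
  - pose proof (starts_mono (S (block i)) k Hlt); lia.
  - pose proof (starts_mono (S k) (block i) Hlt); lia.
Qed.

End Blocks.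

(* [U] is the concatenation of the blocks [Y k], separated by gaps long enough that
   all blocks after the [k]-th are negligible when seen from its starting point. *)
Lemma universal_sequence (h : nat -> R) (q : R) (Y : nat -> nat -> C) : 0 < q ->
  (forall i, 0 <= h i) -> ex_series h ->
  (forall k, exists d, forall i, (d <= i)%nat -> Y k i = RtoC 0) ->
  exists U n, (exists B, sums_le (fun i => rpow (Cmod (U i)) q * h i) B) /\
    forall k, sums_le (fun i => rpow (Cmod (U (i + n k)%nat - Y k i)%C) q * h i) (/ 2 ^ k).
Proof.
  intros Hq Hh Hex HY.
  (* For each block: a position s beyond which it is zero and R times [h] has tail at most 2^-k,
     where R bounds the powers of its entries. *)
  assert (Hchoice : forall k, exists sR : nat * R,
    (forall i, (fst sR <= i)%nat -> Y k i = RtoC 0) /\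
    (forall i, rpow (Cmod (Y k i)) q <= snd sR) /\ 0 <= snd sR /\
    (forall M, (fst sR <= M)%nat ->
       sums_le (tail (G := R_AbelianMonoid) M (fun i => snd sR * h i)) (/ 2 ^ k))).
  { intros k; destruct (HY k) as [d Hd].
    destruct (eventually_le_bounded (fun i => rpow (Cmod (Y k i)) q) d 0) as [B [HB0 HB]].
    { intros i Hi; rewrite Hd, Cmod_0, rpow_zero by assumption; lra. }
    destruct (sums_le_tail (fun i => B * h i) (/ 2 ^ k)) as [N HN].
    { exact (ex_series_scal_l (V := R_NormedModule) B h Hex). }
    { apply Rinv_0_lt_compat, pow_lt; lra. }
    exists ((d + N)%nat, B); simpl; split; [|split; [exact HB | split; [exact HB0|]]].
    - intros i Hi; apply Hd; lia.
    - intros M HM; apply HN; lia. }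
  apply fun_choice in Hchoice; destruct Hchoice as [sR HsR].
  pose (s := fun k => fst (sR k)); pose (R' := fun k => snd (sR k)).
  (* The summand [s j] leaves room for block j; [s (S j)] puts block j + 1 so far from every earlier
     start that it sees only a tail of [h] of weight at most 2^-(j+1). *)
  pose (n := fix n k := match k with O => O | S j => (n j + (s j + s (S j) + 1))%nat end).
  assert (Hn0 : n 0%nat = 0%nat) by reflexivity.
  assert (HnS : forall k, n (S k) = (n k + (s k + s (S k) + 1))%nat) by reflexivity.
  assert (Hn : forall k, (n k < n (S k))%nat) by (intros k; rewrite HnS; lia).
  clearbody n.
  pose (U := fun i => Y (block n i) (i - n (block n i))%nat).
  assert (HU : forall k i, (n k <= i < n (S k))%nat -> U i = Y k (i - n k)%nat).
  { intros k i Hi; unfold U; now rewrite (block_unique n Hn Hn0 i k Hi). }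
  assert (Hmain : forall k,
    sums_le (fun i => rpow (Cmod (U (i + n k)%nat - Y k i)%C) q * h i) (/ 2 ^ k)).
  { intros k; set (F := fun i => rpow (Cmod (U (i + n k)%nat - Y k i)%C) q * h i).
    assert (HF0 : forall i, 0 <= F i)
      by (intros i; apply Rmult_le_pos; [apply rpow_ge0 | apply Hh]).
    (* Seen from the start of block k, that block contributes 0 and each later block j at most 2^-j;
       the right-hand side is the resulting geometric sum. *)
    assert (Hblocks : forall J,
      sum_n F (n (S k + J) - n k - 1)%nat <= / 2 ^ k - / 2 ^ (k + J)).
    { induction J as [|J IH].
      - rewrite !Nat.add_0_r, Rminus_diag_eq by reflexivity.
        assert (Hz : forall i, (i < n (S k) - n k)%nat -> F i = 0).
        { intros i Hi; unfold F; rewrite (HU k) by lia.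
          replace (i + n k - n k)%nat with i by lia.
          unfold Cminus; rewrite Cplus_opp_r, Cmod_0, rpow_zero; ring. }
        assert (Hz' : forall m, (m < n (S k) - n k)%nat -> sum_n F m = 0).
        { induction m as [|m IHm]; intros Hm; [rewrite sum_O; now apply Hz|].
          rewrite sum_n_RS, IHm, Hz by lia; apply Rplus_0_r. }
        rewrite Hz'; [lra | pose proof (Hn k); lia].
      - set (j := (S k + J)%nat) in *.
        assert (HjS : (S k + S J)%nat = S j) by (unfold j; lia); rewrite HjS.
        assert (Hkj : (n (S k) <= n j)%nat) by (apply (starts_mono n Hn); unfold j; lia).
        pose proof (Hn j) as Hnj; pose proof (HnS k) as Hnk.
        assert (Hgap : (s j <= n j - n k)%nat).
        { unfold j in *; rewrite Nat.add_succ_l in *; pose proof (HnS (k + J)%nat).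
          pose proof (starts_mono n Hn k (k + J)%nat ltac:(lia)); lia. }
        unfold sum_n.
        rewrite (sum_n_m_Chasles F 0 (n j - n k - 1) (n (S j) - n k - 1)) by lia.
        replace (S (n j - n k - 1)) with (n j - n k)%nat by lia.
        assert (Hnew : sum_n_m F (n j - n k) (n (S j) - n k - 1) <= / 2 ^ j).
        { destruct (HsR j) as [_ [HR [_ Ht]]]; specialize (Ht _ Hgap (n (S j) - n k - 1)%nat).
          rewrite <- sum_n_tail.
          eapply Rle_trans; [|exact Ht].
          assert (Hpt : forall m, (m <= n (S j) - n k - 1)%nat ->
            sum_n (tail (G := R_AbelianMonoid) (n j - n k) F) m
            <= sum_n (tail (G := R_AbelianMonoid) (n j - n k) (fun i => R' j * h i)) m).
          { assert (Hterm : forall i, (i <= n (S j) - n k - 1)%nat ->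
              tail (G := R_AbelianMonoid) (n j - n k) F i
              <= tail (G := R_AbelianMonoid) (n j - n k) (fun i => R' j * h i) i).
            { intros i Hi; unfold tail; destruct (Nat.ltb_spec i (n j - n k));
                [apply Rle_refl|].
              (* Inside a later block [Y k] is already zero, so only the entries of [Y j] remain. *)
              unfold F; rewrite (HU j) by lia.
              destruct (HsR k) as [Hz _]; rewrite (Hz i) by (fold (s k); lia).
              unfold Cminus; rewrite Copp_0, Cplus_0_r.
              apply Rmult_le_compat_r; [apply Hh | apply HR]. }
            induction m as [|m IHm]; intros Hm; [rewrite !sum_O; now apply Hterm|].
            rewrite !sum_n_RS; apply Rplus_le_compat; [apply IHm; lia | now apply Hterm]. }
          apply Hpt; lia. }
        change (sum_n F (n j - n k - 1) + sum_n_m F (n j - n k) (n (S j) - n k - 1)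
                <= / 2 ^ k - / 2 ^ (k + S J)).
        replace (k + S J)%nat with j by (unfold j; lia).
        assert (E : / 2 ^ (k + J) = 2 * / 2 ^ j).
        { unfold j; simpl; field; apply pow_nonzero; lra. }
        lra. }
    intros N; eapply Rle_trans; [apply (sum_n_incr F N (n (S k + N) - n k - 1 - N)%nat HF0)|].
    pose proof (starts_add n Hn (S k) N); pose proof (Hn k).
    replace (N + (n (S k + N) - n k - 1 - N))%nat with (n (S k + N) - n k - 1)%nat by lia.
    eapply Rle_trans; [apply Hblocks|].
    assert (0 < / 2 ^ (k + N)) by (apply Rinv_0_lt_compat, pow_lt; lra); lra. }
  exists U, n; split; [|exact Hmain].
  (* Summability of [U] itself is the case k = 0: block 0 starts at 0, and [Y 0] is bounded. *)
  destruct (HsR 0%nat) as [_ [HR [HR0 _]]].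
  eexists; eapply sums_le_mono; [|exact (sums_le_scal _ _ _ (rpow_ge0 2 q)
    (sums_le_plus _ _ _ _ (Hmain 0%nat) (sums_le_scal _ _ _ HR0 (sums_le_Series _ Hh Hex))))].
  intros i; cbv beta; rewrite Hn0, Nat.add_0_r.
  apply Rle_trans with (rpow 2 q * (rpow (Cmod (U i - Y 0%nat i)%C) q
                                    + rpow (Cmod (Y 0%nat i)) q) * h i).
  - apply Rmult_le_compat_r; [apply Hh|].
    eapply Rle_trans; [|apply rpow_add_le; try apply Cmod_ge_0; lra].
    apply rpow_le; [lra | apply Cmod_ge_0|].
    replace (U i) with ((U i - Y 0%nat i) + Y 0%nat i)%C at 1 by ring.
    apply Cmod_triangle.
  - rewrite Rmult_assoc, Rmult_plus_distr_r.
    apply Rmult_le_compat_l; [apply rpow_ge0|]; apply Rplus_le_compat_l.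
    apply Rmult_le_compat_r; [apply Hh | apply HR].
Qed.

(** * Dynamics of the adjoint *)

Section Dynamics.
Variables (a b w : nat -> C) (p q : R).
Hypotheses (Hp : 1 < p) (Hq : / p + / q = 1).
Hypotheses (Ha : forall n, a n <> RtoC 0) (Hw : forall n, w n <> RtoC 0).
Hypothesis Hrad :
  Rbar_lt (LimSup_seq (fun n => rpow (Cmod (a n) + Cmod (b n)) (/ INR n))) p_infty.
Hypothesis Hsup : exists M, forall n, Cmod (Cdiv (Cmult (w n) (a n)) (a (S n))) <= M.
Hypothesis Hlim : Rbar_lt (LimSup_seq (fun n => Cmod (Cdiv (b n) (a (S n))))) (Finite 1).

Local Notation T := (Fwstar a b w).
Local Notation RepE := (Rep a b w p).

Definition gamq (n : nat) : R := rpow (Cmod (gam a w n)) q.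

Local Notation wsum_le U B := (sums_le (fun n => rpow (Cmod (U n)) q * gamq n) B).

Let Hq1 : 1 < q := conj_exponent_gt1 p q Hp Hq.

Lemma gamq_ge0 n : 0 <= gamq n.
Proof. apply rpow_ge0. Qed.

Lemma scaled_wsum U n : rpow (Cmod (scaled a w U n)) q = rpow (Cmod (U n)) q * gamq n.
Proof. unfold scaled; rewrite Cmod_mult, rpow_mult; [reflexivity | apply Cmod_ge_0 ..]. Qed.

Lemma wsum_scaled U B : wsum_le U B -> sums_le (fun n => rpow (Cmod (scaled a w U n)) q) B.
Proof. apply sums_le_mono; intros n; rewrite scaled_wsum; apply Rle_refl. Qed.

Lemma scaled_wsum_le U B : sums_le (fun n => rpow (Cmod (scaled a w U n)) q) B -> wsum_le U B.
Proof. apply sums_le_mono; intros n; rewrite scaled_wsum; apply Rle_refl. Qed.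

Lemma dual_of_seq U B : wsum_le U B -> exists phi, RepE U phi /\ inDual a b p phi.
Proof.
  intros HB; apply wsum_scaled in HB.
  destruct (Rep_exists a b w p q Hp Hq Ha Hw Hrad Hlim U B HB) as [phi HR].
  exists phi; split; [exact HR|].
  now apply (Rep_inDual a b w p q Hp Hq Ha Hw Hrad Hlim U phi B).
Qed.

Lemma seq_of_dual phi : inDual a b p phi -> exists U B, RepE U phi /\ wsum_le U B.
Proof.
  intros Hphi; destruct (inDual_Rep a b w p q Hp Hq Ha Hw Hrad Hlim phi Hphi)
    as [U [B [HR HB]]].
  exists U, B; split; [exact HR | now apply scaled_wsum_le].
Qed.

Lemma fsub_dnorm_lt eps : 0 < eps -> exists d, 0 < d /\
  forall U V phi psi, RepE U phi -> RepE V psi ->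
    wsum_le (fun n => Cminus (U n) (V n)) d -> dnorm_lt a b p (fsub phi psi) eps.
Proof.
  intros Heps.
  destruct (Rep_dnorm_lt a b w p q Hp Hq Ha Hw Hrad Hlim eps Heps) as [d [Hd H]].
  exists d; split; [exact Hd|]; intros U V phi psi HU HV HB.
  apply (H (fun n => Cminus (U n) (V n))); [now apply Rep_fsub | now apply wsum_scaled].
Qed.

Lemma rpow_sub_le x y z : rpow (Cmod (x - z)%C) q
  <= rpow 2 q * (rpow (Cmod (x - y)%C) q + rpow (Cmod (y - z)%C) q).
Proof.
  eapply Rle_trans; [|apply rpow_add_le; try apply Cmod_ge_0; lra].
  apply rpow_le; [lra | apply Cmod_ge_0|].
  replace (x - z)%C with ((x - y) + (y - z))%C by ring; apply Cmod_triangle.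
Qed.

Lemma summable_hypercyclic : ex_series gamq -> hypercyclic a b p T.
Proof.
  intros Hex; destruct finite_seqs_dense as [Y [HY0 HY]].
  destruct (universal_sequence gamq q Y ltac:(lra) gamq_ge0 Hex HY0)
    as [U [n [[B HB] HU]]].
  destruct (dual_of_seq U B HB) as [phi [HR Hphi]].
  exists phi; split; [exact Hphi|].
  intros psi Hpsi eps Heps.
  destruct (fsub_dnorm_lt eps Heps) as [d [Hd Hdn]].
  destruct (seq_of_dual psi Hpsi) as [Z [BZ [HZ HBZ]]].
  pose proof (rpow_gt0 2 q ltac:(lra)) as H2.
  (* Three errors share d: the blocks after the k-th, the rational approximation below N, and the
     tail of [Z]. The factor 2^q comes from [rpow_sub_le]. *)
  pose (t := d / (3 * rpow 2 q)).
  assert (Ht : 0 < t) by (apply Rdiv_lt_0_compat; lra).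
  pose proof (Series_nneg gamq gamq_ge0 Hex) as HH; set (H := Series gamq) in *.
  destruct (sums_le_tail (fun i => rpow (Cmod (Z i)) q * gamq i) t) as [N HN].
  { eapply sums_le_ex_series; [|exact HBZ].
    intros i; apply Rmult_le_pos; [apply rpow_ge0 | apply gamq_ge0]. }
  { exact Ht. }
  specialize (HN N (Nat.le_refl N)).
  destruct (pow_lt_1_zero (/ 2) ltac:(rewrite Rabs_pos_eq; lra) t Ht) as [K HK].
  (* Chosen so that eta^q H <= t, the cost of an error eta in every entry. *)
  pose (eta := rpow (t / (H + 1)) (/ q)).
  assert (Hth : 0 < t / (H + 1)) by (apply Rdiv_lt_0_compat; lra).
  assert (Heta : 0 < eta) by now apply rpow_gt0.
  destruct (HY Z N eta K Heta) as [k [Hk [Hclose Hzero]]].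
  exists (n k).
  apply Hdn with (fun i => U (i + n k)%nat) Z; [now apply Rep_iter | exact HZ|].
  assert (Hsum : sums_le (fun i => rpow 2 q *
     (rpow (Cmod (U (i + n k)%nat - Y k i)%C) q * gamq i
      + (rpow eta q * gamq i
         + tail (G := R_AbelianMonoid) N (fun i => rpow (Cmod (Z i)) q * gamq i) i)))
     (rpow 2 q * (/ 2 ^ k + (rpow eta q * H + t)))).
  { apply (sums_le_scal (fun i => rpow (Cmod (U (i + n k)%nat - Y k i)%C) q * gamq i
      + (rpow eta q * gamq i
         + tail (G := R_AbelianMonoid) N (fun i => rpow (Cmod (Z i)) q * gamq i) i)));
      [lra|].
    apply (sums_le_plus _ _ _ _ (HU k)).
    exact (sums_le_plus _ _ _ _
      (sums_le_scal _ _ _ (rpow_ge0 eta q) (sums_le_Series _ gamq_ge0 Hex)) HN). }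
  assert (Hbd : rpow 2 q * (/ 2 ^ k + (rpow eta q * H + t)) <= d).
  { apply Rle_trans with (rpow 2 q * (t + (t + t))).
    - apply Rmult_le_compat_l; [lra|]; apply Rplus_le_compat.
      + specialize (HK k Hk); rewrite pow_inv in HK; left.
        eapply Rle_lt_trans; [apply Rle_abs | exact HK].
      + apply Rplus_le_compat_r; unfold eta; rewrite rpow_inv_l by lra.
        apply (Rmult_le_reg_r (H + 1)); [lra|].
        replace (t / (H + 1) * H * (H + 1)) with (t * H) by (field; lra); nra.
    - right; unfold t; field; lra. }
  intros M; eapply Rle_trans; [|exact Hbd]; revert M.
  eapply sums_le_mono; [|exact Hsum]; intros i; cbv beta.
  eapply Rle_trans; [apply Rmult_le_compat_r;
    [apply gamq_ge0 | apply (rpow_sub_le _ (Y k i))]|].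
  rewrite Rmult_assoc, Rmult_plus_distr_r.
  apply Rmult_le_compat_l; [lra|]; apply Rplus_le_compat_l.
  unfold tail; destruct (Nat.ltb_spec i N) as [Hi | Hi].
  - change (@zero R_AbelianMonoid) with 0; rewrite Rplus_0_r.
    apply Rmult_le_compat_r; [apply gamq_ge0|].
    apply rpow_le; [lra | apply Cmod_ge_0 | now apply Hclose].
  - rewrite (Hzero i Hi).
    replace (0 - Z i)%C with (- Z i)%C by ring; rewrite Cmod_opp.
    pose proof (Rmult_le_pos _ _ (rpow_ge0 eta q) (gamq_ge0 i)); lra.
Qed.

Lemma summable_dense_periodic : ex_series gamq -> dense_periodic a b p T.
Proof.
  intros Hex psi Hpsi eps Heps.
  destruct (fsub_dnorm_lt eps Heps) as [d [Hd Hdn]].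
  destruct (seq_of_dual psi Hpsi) as [Z [BZ [HZ HBZ]]].
  pose proof (rpow_gt0 2 q ltac:(lra)) as H2.
  pose (t := d / (2 * rpow 2 q)).
  assert (Ht : 0 < t) by (apply Rdiv_lt_0_compat; lra).
  destruct (sums_le_tail (fun i => rpow (Cmod (Z i)) q * gamq i) t) as [N HN].
  { eapply sums_le_ex_series; [|exact HBZ].
    intros i; apply Rmult_le_pos; [apply rpow_ge0 | apply gamq_ge0]. }
  { exact Ht. }
  specialize (HN N (Nat.le_refl N)).
  destruct (eventually_le_bounded (fun i => rpow (Cmod (head N Z i)) q) N 0) as [R' [HR0 HR]].
  { intros i Hi; unfold head; apply Nat.ltb_ge in Hi; rewrite Hi, Cmod_0, rpow_zero; lra. }
  destruct (sums_le_tail (fun i => R' * gamq i) t) as [M HM].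
  { exact (ex_series_scal_l (V := R_NormedModule) R' gamq Hex). }
  { exact Ht. }
  (* The period exceeds N, so a whole truncation fits, and M, so all repetitions fall where their
     weighted sum is at most t. *)
  pose (m := (S (N + M))%nat); specialize (HM m ltac:(lia)).
  pose (V := fun i => head N Z (i mod m)).
  assert (HVB : wsum_le V (R' * Series gamq)).
  { eapply sums_le_mono; [|exact (sums_le_scal _ _ _ HR0 (sums_le_Series _ gamq_ge0 Hex))].
    intros i; apply Rmult_le_compat_r; [apply gamq_ge0 | apply HR]. }
  destruct (dual_of_seq V _ HVB) as [phi [HRV Hphi]].
  exists phi; split; [exact Hphi | split].
  - exists m; split; [lia|]; intros f Hf.
    eapply cseries_unique; [|apply (HRV f Hf)].
    generalize (Rep_iter a b w p Hp Ha Hw Hrad Hsup Hlim V phi m HRV f Hf).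
    apply cseries_ext; intros i; unfold V.
    replace ((i + m) mod m) with (i mod m); [reflexivity|].
    rewrite <- (Nat.mul_1_l m) at 2; symmetry; apply Nat.Div0.mod_add.
  - apply (Hdn V Z phi psi HRV HZ).
    (* The error is 0 below N, the tail of [Z] from N to m, and beyond m that tail together with the
       repetitions. *)
    assert (Hsum : sums_le (fun i => rpow 2 q *
      (tail (G := R_AbelianMonoid) m (fun i => R' * gamq i) i
       + tail (G := R_AbelianMonoid) N (fun i => rpow (Cmod (Z i)) q * gamq i) i)) d).
    { replace d with (rpow 2 q * (t + t)) by (unfold t; field; lra).
      exact (sums_le_scal _ _ _ (Rlt_le _ _ H2) (sums_le_plus _ _ _ _ HM HN)). }
    eapply sums_le_mono; [|exact Hsum]; intros i; cbv beta.
    pose proof (gamq_ge0 i) as Hg; pose proof (rpow_ge0 (Cmod (Z i)) q) as Hz.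
    unfold tail; destruct (Nat.ltb_spec i m) as [Him | Him].
    + unfold V; rewrite Nat.mod_small by assumption; unfold head.
      change (@zero R_AbelianMonoid) with 0.
      destruct (Nat.ltb_spec i N).
      * unfold Cminus; rewrite Cplus_opp_r, Cmod_0, rpow_zero; lra.
      * replace (0 - Z i)%C with (- Z i)%C by ring; rewrite Cmod_opp.
        assert (1 <= rpow 2 q).
        { rewrite rpow_pos by lra; rewrite <- (Rpower_O 2) by lra; apply Rle_Rpower; lra. }
        pose proof (Rmult_le_pos _ _ Hz Hg); nra.
    + destruct (Nat.ltb_spec i N); [lia|].
      eapply Rle_trans; [apply Rmult_le_compat_r;
        [exact Hg | apply (rpow_sub_le _ (RtoC 0))]|].
      replace (V i - 0)%C with (V i) by ring.
      replace (0 - Z i)%C with (- Z i)%C by ring; rewrite Cmod_opp.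
      rewrite Rmult_assoc, Rmult_plus_distr_r.
      apply Rmult_le_compat_l; [lra|]; apply Rplus_le_compat_r.
      apply Rmult_le_compat_r; [exact Hg | apply HR].
Qed.

(** Let psi pick the constant Taylor coefficient, so psi(1) = 1. A periodic phi within 1 / (||1|| +
    1) of psi satisfies |phi(1) - 1| < 1, hence phi(1) is nonzero. *)
Lemma chaotic_nonzero_periodic : chaotic a b p T -> nonzero_periodic a b p T.
Proof.
  intros [_ Hdense].
  assert (HB : wsum_le (delta 0) (gamq 0)).
  { intros N; right; induction N as [|N IH].
    - rewrite sum_O; unfold delta; simpl.
      rewrite Cmod_1, rpow_pos by lra.
      unfold Rpower; rewrite ln_1, Rmult_0_r, exp_0; apply Rmult_1_l.
    - rewrite sum_n_RS, IH; unfold delta; simpl.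
      rewrite Cmod_0, rpow_zero, Rmult_0_l; apply Rplus_0_r. }
  destruct (dual_of_seq _ _ HB) as [psi [HR Hpsi]].
  pose (f := fun z : C => Cpow z 0).
  assert (Hf : inE a b p f) by now apply monomial_inE.
  assert (Hpf : psi f = RtoC 1).
  { unfold f; rewrite (Rep_monomial a b w p Hp Ha Hw Hrad Hlim _ psi 0 HR).
    unfold delta; simpl; field; exact C1_nz. }
  pose proof (rpow_ge0 (Series (fun n => rpow (Cmod (coefs a b p f n)) p)) (/ p)) as Hn.
  fold (normE a b p f) in Hn.
  destruct (Hdense psi Hpsi (/ (normE a b p f + 1))) as [phi [Hphi [Hper [c [Hc0 [Hc Hd]]]]]].
  { apply Rinv_0_lt_compat; lra. }
  exists phi; split; [exact Hphi | split; [exact Hper|]].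
  exists f; split; [exact Hf|]; intros E.
  specialize (Hd f Hf); unfold fsub in Hd; rewrite E, Hpf in Hd.
  replace (0 - 1)%C with (- (1))%C in Hd by ring; rewrite Cmod_opp, Cmod_1 in Hd.
  apply (Rmult_lt_compat_r (normE a b p f + 1)) in Hc; [|lra].
  rewrite Rinv_l in Hc by lra; nra.
Qed.

Lemma gamq_ratio : exists K, 1 <= K /\ forall n, gamq n <= K * gamq (S n).
Proof.
  destruct Hsup as [M HM].
  assert (HM0 : 0 <= M) by (eapply Rle_trans; [apply Cmod_ge_0 | apply (HM 0%nat)]).
  (* From g_n = (w_n a_n / a_(n+1)) g_(n+1). Adding 1 makes K >= 1, so that its powers increase. *)
  exists (1 + rpow M q); split; [pose proof (rpow_ge0 M q); lra|].
  intros n; apply Rle_trans with (rpow M q * gamq (S n)).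
  - unfold gamq; rewrite <- rpow_mult by (try apply Cmod_ge_0; lra).
    apply rpow_le; [lra | apply Cmod_ge_0|].
    replace (gam a w n) with ((w n * a n / a (S n)) * gam a w (S n))%C.
    + rewrite Cmod_mult; apply Rmult_le_compat_r; [apply Cmod_ge_0 | apply HM].
    + unfold gam; simpl; field; repeat split; try apply Ha; try apply Hw; now apply wprod_neq0.
  - pose proof (gamq_ge0 (S n)); lra.
Qed.

(* A nonzero periodic [U] is bounded below along an arithmetic progression; the bound
   [|w_n a_n / a_(n+1)| <= M] then controls [gamq] on the remaining residue classes. *)
Lemma nonzero_periodic_summable : nonzero_periodic a b p T -> ex_series gamq.
Proof.
  intros [phi [Hphi [[m [Hm Hper]] [f [Hf Hne]]]]].
  destruct (seq_of_dual phi Hphi) as [U [B [HR HB]]].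
  assert (HU : forall n, U (n + m)%nat = U n).
  { exact (Rep_inj a b w p Hp Ha Hw Hrad Hlim _ U _ phi
             (Rep_iter a b w p Hp Ha Hw Hrad Hsup Hlim U phi m HR) HR Hper). }
  assert (Hex : exists i0, U i0 <> RtoC 0).
  { apply NNPP; intros Hno; apply Hne.
    eapply cseries_unique; [apply (HR f Hf)|].
    set (u := fun n => _).
    assert (Hz : forall n, u n = RtoC 0).
    { intros n; unfold u; destruct (excluded_middle_informative (U n = RtoC 0)) as [-> | Hn].
      - unfold Cdiv; rewrite !Cmult_0_l; reflexivity.
      - exfalso; apply Hno; now exists n. }
    rewrite <- (Hz 0%nat); apply cseries_single; intros; apply Hz. }
  destruct Hex as [i0 Hi0].
  assert (HUmul : forall k n, U (n + k * m)%nat = U n).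
  { induction k as [|k IH]; intros n; [now rewrite Nat.add_0_r|].
    simpl; replace (n + (m + k * m))%nat with (n + k * m + m)%nat by lia.
    now rewrite HU. }
  destruct gamq_ratio as [K [HK Hratio]].
  assert (HKl : forall l n, gamq n <= K ^ l * gamq (n + l)%nat).
  { induction l as [|l IH]; intros n; [rewrite Nat.add_0_r; simpl; lra|].
    eapply Rle_trans; [apply IH|].
    replace (K ^ S l * gamq (n + S l)%nat) with (K ^ l * (K * gamq (S (n + l))))
      by (rewrite Nat.add_succ_r; simpl; ring).
    apply Rmult_le_compat_l; [apply pow_le; lra | apply Hratio]. }
  pose (u := fun n => rpow (Cmod (U n)) q * gamq n).
  assert (Hu : forall n, 0 <= u n)
    by (intros; apply Rmult_le_pos; [apply rpow_ge0 | apply gamq_ge0]).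
  pose (c := rpow (Cmod (U i0)) q).
  assert (Hc : 0 < c) by (apply rpow_gt0, Cmod_gt_0, Hi0).
  (* The window of length m + 1 from i meets the progression where [U] equals [U i0]; at most m
     ratio steps carry the bound back to i. Such window sums are summable over i. *)
  assert (Hpt : forall i, gamq i <= / c * K ^ m * sum_n (fun l => u (i + l)%nat) m).
  { intros i.
    assert (Hl : exists l, (l <= m)%nat /\ U (i + l)%nat = U i0).
    { pose (r := (i0 mod m)%nat); pose (s := (i mod m)%nat).
      pose proof (Nat.mod_upper_bound i0 m ltac:(lia)); fold r in H.
      pose proof (Nat.mod_upper_bound i m ltac:(lia)); fold s in H0.
      pose proof (Nat.div_mod_eq i0 m) as E0; fold r in E0.
      pose proof (Nat.div_mod_eq i m) as E1; fold s in E1.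
      assert (Hr : U i0 = U r)
        by (rewrite E0, Nat.add_comm, Nat.mul_comm; apply HUmul).
      destruct (Nat.le_gt_cases s r) as [Hsr | Hsr].
      - exists (r - s)%nat; split; [lia|].
        rewrite Hr; replace (i + (r - s))%nat with (r + (i / m) * m)%nat by lia.
        apply HUmul.
      - exists (m + r - s)%nat; split; [lia|].
        rewrite Hr; replace (i + (m + r - s))%nat with (r + (S (i / m)) * m)%nat
          by (simpl; lia).
        apply HUmul. }
    destruct Hl as [l [Hlm HUl]].
    assert (Hterm : u (i + l)%nat <= sum_n (fun l => u (i + l)%nat) m).
    { replace m with (l + (m - l))%nat by lia.
      eapply Rle_trans; [|apply sum_n_incr; intros; apply Hu].
      destruct l as [|l]; [rewrite sum_O; apply Rle_refl|].
      rewrite sum_n_RS.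
      pose proof (sum_n_nneg (fun l => u (i + l)%nat) l (fun l => Hu _)); lra. }
    assert (Hul : u (i + l)%nat = c * gamq (i + l)%nat) by (unfold u; now rewrite HUl).
    assert (HKm : K ^ l <= K ^ m) by (apply Rle_pow; assumption).
    pose proof (gamq_ge0 (i + l)) as Hg; pose proof (pow_le K m ltac:(lra)) as HKm0.
    apply Rle_trans with (K ^ m * gamq (i + l)%nat).
    - eapply Rle_trans; [apply HKl | now apply Rmult_le_compat_r].
    - apply (Rmult_le_reg_l c); [exact Hc|].
      replace (c * (/ c * K ^ m * sum_n (fun l => u (i + l)%nat) m))
        with (K ^ m * sum_n (fun l => u (i + l)%nat) m) by (field; lra).
      replace (c * (K ^ m * gamq (i + l)%nat)) with (K ^ m * u (i + l)%nat)
        by (rewrite Hul; ring).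
      now apply Rmult_le_compat_l. }
  eapply sums_le_ex_series; [apply gamq_ge0|].
  eapply sums_le_mono; [exact Hpt|].
  apply (sums_le_scal (fun i => sum_n (fun l => u (i + l)%nat) m)).
  - apply Rmult_le_pos; [left; now apply Rinv_0_lt_compat | apply pow_le; lra].
  - apply sums_le_window; [exact Hu | exact HB].
Qed.

End Dynamics.

Theorem mainTheorem6 (a b w : nat -> C) (p q : R)
  (Hp : 1 < p) (Hq : / p + / q = 1)
  (Ha : forall n, a n <> RtoC 0) (Hb : forall n, b n <> RtoC 0)
  (Hw : forall n, w n <> RtoC 0)
  (Hrad : Rbar_lt (LimSup_seq (fun n => rpow (Cmod (a n) + Cmod (b n)) (/ INR n))) p_infty)
  (Hsup : exists M, forall n, Cmod (Cdiv (Cmult (w n) (a n)) (a (S n))) <= M)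
  (Hlim : Rbar_lt (LimSup_seq (fun n => Cmod (Cdiv (b n) (a (S n))))) (Finite 1)) :
  let T := Fwstar a b w in
  let iii := ex_series (fun n => rpow (Cmod (Cdiv (a (S n)) (wprod w (S n)))) q) in
  (iii -> chaotic a b p T) /\
  (chaotic a b p T -> nonzero_periodic a b p T) /\
  ((forall n, ex_series (fun j => rpow (Cmod (baprod a b n (S j))) p)) ->
   ex_series (fun n => rpow (Series (fun j => rpow (Cmod (baprod a b n (S j))) p)) (q / p)) ->
   nonzero_periodic a b p T -> iii).
Proof.
  intros T iii.
  (* Condition (iii) starts at n = 1; the term of index 0 does not affect convergence. *)
  assert (Hiii : iii <-> ex_series (gamq a w q))
    by (symmetry; apply (ex_series_incr_1 (V := R_NormedModule) (gamq a w q))).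
  split; [|split].
  - intros H; apply Hiii in H; split.
    + now apply (summable_hypercyclic a b w p q).
    + now apply (summable_dense_periodic a b w p q).
  - now apply (chaotic_nonzero_periodic a b w p q).
  - intros _ _ H; apply Hiii; now apply (nonzero_periodic_summable a b w p q).
Qed.
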